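(* Assume the sparsity and non-degeneracy assumptions stated in the context. For every sequence of positive integers $t=t_n=\Theta(\log n)$ and every fixed $\varepsilon>0$, the event $$\left\{\rho(t)\notin\left[e^{-(1+\varepsilon)\mathrm H t},\,e^{-(1-\varepsilon)\mathrm H t}\right]\right\}$$ is uniformly unlikely, i.e. $$\max_{i\in[n]}Q_i\left(\rho(t)\notin\left[e^{-(1+\varepsilon)\mathrm H t},\,e^{-(1-\varepsilon)\mathrm H t}\right]\right)\longrightarrow0\quad\text{in probability as } n\to\infty.$$
   Context: For each $n$, write $[n]=\{1,\dots,n\}$ and let $p_{i,1}\ge\dots\ge p_{i,n}\ge 0$, $i\in[n]$, be given deterministic numbers with $\sum_{j=1}^n p_{i,j}=1$ (their dependence on $n$ is implicit). Let $\sigma=(\sigma_i)_{1\le i\le n}$ be independent, uniformly random permutations of $[n]$ (the environment), and set $P(i,j):=p_{i,\sigma_i^{-1}(j)}$. With $0\log0=0$, let $\mathrm H:=-\frac1n\sum_{i,j=1}^n p_{i,j}\log p_{i,j}$. Assumptions (as $n\to\infty$). Sparsity: $\mathrm H=O(1)$ and $\max_{i\in[n]}\sum_{j=1}^n p_{i,j}(\log p_{i,j})^2=o(\log n)$. Non-degeneracy: $\limsup_{n\to\infty}\big\{\frac1n\sum_{i,j=1}^n\mathbf 1_{\{p_{i,j}>1-\varepsilon\}}\big\}\to 0$ as $\varepsilon\to0^+$. For a fixed realization of $\sigma$, $Q_i$ denotes the (quenched) law of the Markov chain $X_0,X_1,\dots$ with transition matrix $P$ and $X_0=i$, together with the weights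 $W_s:=P(X_{s-1},X_s)$; the total weight up to time $t$ is $\rho(t):=\prod_{s=1}^t W_s$. A trajectorial event $A$ (depending on $n$) is called uniformly unlikely if $\max_{i\in[n]}Q_i(A)\to0$ in probability (with respect to $\sigma$) as $n\to\infty$. $t=\Theta(\log n)$ means $t/\log n$ remains bounded away from $0$ and $\infty$. *)

(* Defs.v *)
From HB Require Import structures.
From mathcomp Require Import all_boot all_order all_algebra all_fingroup.
From mathcomp Require Import all_classical all_reals all_analysis.

Set Implicit Arguments.
Unset Strict Implicit.
Unset Printing Implicit Defensive.

Import Order.TTheory GRing.Theory Num.Theory.
Import numFieldNormedType.Exports.

Local Open Scope classical_set_scope.
Local Open Scope ring_scope.

(* States are 'I_n, i.e.,
   {0, .., n-1} in place of {1, .., n}. *)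

(* A sequence indexed by all n : nat; n = 0 is vacuous and irrelevant. *)
Definition ranked_rows (R : realType) (p : forall n, 'M[R]_n) : Prop :=
  forall n (i : 'I_n),
    [/\ forall j k : 'I_n, (j <= k)%N -> p n i k <= p n i j,
        forall j : 'I_n, 0 <= p n i j
      & \sum_(j < n) p n i j = 1].

(* The convention 0 log 0 = 0 is automatic, as x * ln x is 0 at x = 0. *)
Definition entropy (R : realType) (n : nat) (p : 'M[R]_n) : R :=
  - (n%:R^-1 * \sum_(i < n) \sum_(j < n) p i j * ln (p i j)).

Definition max_log2 (R : realType) (n : nat) (p : 'M[R]_n) : R :=
  \big[Num.max/0]_(i < n) \sum_(j < n) p i j * ln (p i j) ^+ 2.

Definition sparse_rows (R : realType) (p : forall n, 'M[R]_n) : Prop :=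
  (fun n => entropy (p n) : R^o) =O_\oo (fun=> 1 : R^o) /\
  (fun n => max_log2 (p n) : R^o) =o_\oo (fun n => ln n%:R : R^o).

Definition frac_above (R : realType) (n : nat) (p : 'M[R]_n) (c : R) : R :=
  n%:R^-1 * \sum_(i < n) \sum_(j < n | c < p i j) 1.

Definition nondegenerate_rows (R : realType) (p : forall n, 'M[R]_n) : Prop :=
  (fun e : R => limn_esup (fun n => (frac_above (p n) (1 - e))%:E))
    @ 0^'+ --> 0%E.

Definition uniform_perm d (T : measurableType d) (R : realType)
    (Pr : probability T R) (n : nat) (f : T -> 'S_n) : Prop :=
  forall s : 'S_n,
    measurable (f @^-1` [set s]) /\ Pr (f @^-1` [set s]) = ((n`!)%:R^-1)%:E.

(* Mutual independence; every subfamily is covered by taking A i = setT. *)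
Definition independent_perms d (T : measurableType d) (R : realType)
    (Pr : probability T R) (n : nat) (f : 'I_n -> T -> 'S_n) : Prop :=
  forall A : 'I_n -> set 'S_n,
    Pr (\bigcap_(i in [set: 'I_n]) (f i @^-1` A i)) =
    (\prod_(i < n) Pr (f i @^-1` A i))%E.

Definition random_environment d (T : measurableType d) (R : realType)
    (Pr : probability T R) (n : nat) (sigma : 'I_n -> T -> 'S_n) : Prop :=
  (forall i, uniform_perm Pr (sigma i)) /\ independent_perms Pr sigma.

Definition transition (R : realType) (n : nat) (p : 'M[R]_n)
    (s : 'I_n -> 'S_n) : 'M[R]_n :=
  \matrix_(i, j) p i ((s i)^-1%g j).

(* (X_0, .., X_t) *)
Definition trajectory (n t : nat) : finType := {ffun 'I_t.+1 -> 'I_n}.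

Definition weight (R : realType) (n t : nat) (P : 'M[R]_n)
    (x : trajectory n t) : R :=
  \prod_(1 <= s < t.+1) P (x (inord s.-1)) (x (inord s)).

(* The quenched law Q_i, restricted to events determined by (X_0, .., X_t).
   A path started at i has probability \prod_s P(X_(s-1), X_s), which happens
   to be also its total weight. *)
Definition quenched (R : realType) (n t : nat) (P : 'M[R]_n) (i : 'I_n)
    (A : pred (trajectory n t)) : R :=
  \sum_(x : trajectory n t | (x ord0 == i) && A x)
    \prod_(1 <= s < t.+1) P (x (inord s.-1)) (x (inord s)).

(* For each n, the trajectorial event A n is determined by the first t n steps
   of the chain, and may depend on the environment through the transition
   matrix (as the weights do).  No relation is imposed between the probability
   spaces carrying the environments for different n. *)
Definition uniformly_unlikely (R : realType) (d : nat -> measure_display)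
    (T : forall n, measurableType (d n)) (Pr : forall n, probability (T n) R)
    (sigma : forall n, 'I_n -> T n -> 'S_n) (p : forall n, 'M[R]_n)
    (t : nat -> nat) (A : forall n, 'M[R]_n -> pred (trajectory n (t n)))
    : Prop :=
  forall delta : R, 0 < delta ->
    (fun n => Pr n [set w |
       let P := transition (p n) (fun i => sigma n i w) in
       delta < \big[Num.max/0]_(i < n) quenched P i (A n P)])
      @ \oo --> 0%E.

(* Main.v *)
(* A quenched trajectory chooses ranks j with probability p x j and moves from x
   to sigma_x(j); averaging over the environment, each newly used pair (x, j)
   leads to a nearly uniform vertex.  As long as the walk only meets new vertices
   the losses -ln p x j are thus nearly i.i.d. with mean H, and Chebyshev's
   inequality applies since their second moment is o(ln n).  It remains to be
   uniform in the starting point i.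

   Dispersion.  Two cycles among polylogarithmically many revealed edges have
   annealed probability O(polylog / n^2), which survives the union bound over i.
   With at most one cycle, a walk either keeps using new edges, and then its
   weight decays like a power of n except with probability o(1/n); or it goes
   round its cycle, and each turn costs a factor 1 - e0, because with high
   probability no cycle consists of edges of weight above 1 - e0.  Hence after a
   small multiple of ln n steps every walk is light: its weight is below a
   negative power lam of n.  Moreover three distinct walks of the same length
   with the same endpoint create two cycles, so a given vertex is the endpoint of
   a light walk with probability O(lam) only.

   Amplification.  Run k ~ ln n chains from i in the same environment.  By
   dispersion, each chain leaves the vertices seen by its predecessors while its
   weight is still above lam, hence before any relevant loss, and then sees fresh
   vertices.  So the annealed probability that all k chains are atypical is at
   most o(1)^k = o(1/n), whereas it is at least a constant to the power k in an
   environment in which i is bad. *)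

Require Import Defs.
From HB Require Import structures.
From mathcomp Require Import all_boot all_order all_algebra all_fingroup.
From mathcomp Require Import all_classical all_reals all_analysis.
From mathcomp Require Import lra ring zify.

Set Implicit Arguments.
Unset Strict Implicit.
Unset Printing Implicit Defensive.

Import Order.TTheory GRing.Theory Num.Theory.
Import numFieldNormedType.Exports.

Local Open Scope classical_set_scope.
Local Open Scope ring_scope.

(** * Quenched and annealed walks *)

Section Exploration.
Variables (R : realType) (n : nat) (p : 'M[R]_n).
Hypothesis p_ge0 : forall i j, 0 <= p i j.
Hypothesis p_sum1 : forall i, \sum_j p i j = 1.

Local Notation step := ('I_n * 'I_n)%type.
Local Notation edge := ('I_n * 'I_n * 'I_n)%type.
Local Notation env := {ffun 'I_n -> 'S_n}.

Implicit Types (s : env) (E : seq edge) (z : seq step) (x y : 'I_n) (a : step).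

(* The quenched chain picks the rank [j] with probability [p x j] and moves
   from [x] to [s x j]; a trajectory is recorded by its steps [(x, j)] and its
   endpoint. *)
Fixpoint qexp s (m : nat) x (G : seq step -> 'I_n -> R) : R :=
  if m is m'.+1 then
    \sum_j p x j * qexp s m' (s x j) (fun z => G ((x, j) :: z))
  else G [::] x.

Fixpoint walk s x z y : bool :=
  if z is a :: z' then (a.1 == x) && walk s (s a.1 a.2) z' y else x == y.

Definition wt z : R := \prod_(a <- z) p a.1 a.2.

Definition dom E : seq step := map fst E.

Definition lookup E a : option 'I_n := ohead [seq e.2 | e <- E & e.1 == a].

Definition consistent s E : bool := all (fun e => s e.1.1 e.1.2 == e.2) E.

Definition reveal s E a : seq edge :=
  if a \in dom E then E else (a, s a.1 a.2) :: E.

Fixpoint ext s E z : seq edge :=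
  if z is a :: z' then ext s (reveal s E a) z' else E.

(* The annealed chain: [E] is the part of the environment revealed so far, and
   a step along an unrevealed rank lands at a uniform vertex. *)
Fixpoint aexp (m : nat) E x (H : seq step -> seq edge -> 'I_n -> R) : R :=
  if m is m'.+1 then
    \sum_j p x j *
      (if lookup E (x, j) is Some y
       then aexp m' E y (fun z => H ((x, j) :: z))
       else n%:R^-1 * \sum_y
              aexp m' (((x, j), y) :: E) y (fun z => H ((x, j) :: z)))
  else H [::] E x.

(** Counting replaces conditioning: [cnt E / cnt [::]] is the probability that a uniform environment
    extends [E]. *)
Definition cnt E : nat := #|[pred s : env | consistent s E]|.

Lemma leq_bool (b1 b2 : bool) : (b1 -> b2) -> (b1 <= b2)%N.
Proof. by case: b1; case: b2 => // /(_ isT). Qed.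

Lemma ler_bool (b1 b2 : bool) : (b1 -> b2) -> b1%:R <= b2%:R :> R.
Proof. by case: b1; case: b2 => // /(_ isT). Qed.

Lemma wt_ge0 z : 0 <= wt z.
Proof. by rewrite /wt; elim/big_ind: _ => // *; exact: mulr_ge0. Qed.

Lemma p_le1 i j : p i j <= 1.
Proof.
by rewrite -(p_sum1 i) (bigD1 j) //= lerDl sumr_ge0.
Qed.

Lemma wt_le1 z : wt z <= 1.
Proof.
rewrite /wt; elim: z => [|a z IH]; first by rewrite big_nil.
rewrite big_cons mulr_ile1 ?p_le1 //; exact: wt_ge0.
Qed.

Lemma wt_cons a z : wt (a :: z) = p a.1 a.2 * wt z.
Proof. by rewrite /wt big_cons. Qed.

Lemma wt_cat z z' : wt (z ++ z') = wt z * wt z'.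
Proof. by rewrite /wt big_cat. Qed.

Lemma wt_nil : wt [::] = 1.
Proof. by rewrite /wt big_nil. Qed.

Lemma qexp_le s m x G G' :
  (forall z y, size z = m -> walk s x z y -> G z y <= G' z y) ->
  qexp s m x G <= qexp s m x G'.
Proof.
elim: m x G G' => [|m IH] x G G' le_GG' /=; first by apply: le_GG' => /=.
apply: ler_sum => j _; apply: ler_wpM2l => //; apply: IH => z y szz wz.
by apply: le_GG' => /=; rewrite ?szz ?eqxx.
Qed.

Lemma eq_qexp s m x G G' :
  (forall z y, size z = m -> walk s x z y -> G z y = G' z y) ->
  qexp s m x G = qexp s m x G'.
Proof.
by move=> eqG; apply/le_anti/andP; split; apply: qexp_le => z y sz wz; rewrite eqG.
Qed.

Lemma qexp_cst s m x c : qexp s m x (fun _ _ => c) = c.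
Proof.
elim: m x => //= m IH x; under eq_bigr do rewrite IH.
by rewrite -mulr_suml p_sum1 mul1r.
Qed.

Lemma qexpD s m x G G' :
  qexp s m x (fun z y => G z y + G' z y) = qexp s m x G + qexp s m x G'.
Proof.
elim: m x G G' => //= m IH x G G'; rewrite -big_split /=.
by apply: eq_bigr => j _; rewrite IH mulrDr.
Qed.

Lemma qexpZ s m x c G :
  qexp s m x (fun z y => c * G z y) = c * qexp s m x G.
Proof.
elim: m x G => //= m IH x G; rewrite mulr_sumr.
by apply: eq_bigr => j _; rewrite IH mulrCA.
Qed.

Lemma qexp_sum (I : Type) (r : seq I) s m x G :
  qexp s m x (fun z y => \sum_(i <- r) G i z y) =
  \sum_(i <- r) qexp s m x (G i).
Proof.
elim: r => [|i r IH].
  rewrite big_nil -[RHS](qexp_cst s m x); apply: eq_qexp => z y _ _.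
  by rewrite big_nil.
rewrite big_cons -IH -qexpD; apply: eq_qexp => z y _ _; exact: big_cons.
Qed.

Lemma qexp_ge0 s m x G :
  (forall z y, size z = m -> walk s x z y -> 0 <= G z y) -> 0 <= qexp s m x G.
Proof. by move=> G0; rewrite -(qexp_cst s m x 0); exact: qexp_le. Qed.

(** Markov property at time [m]. *)
Lemma qexp_add s m m' x G :
  qexp s (m + m') x G =
  qexp s m x (fun z y => qexp s m' y (fun z' => G (z ++ z'))).
Proof.
elim: m x G => [//|m IH] x G; rewrite addSn /=.
by apply: eq_bigr => j _; rewrite IH.
Qed.

Lemma walk_cat s x z z' y :
  walk s x (z ++ z') y = [exists y', walk s x z y' && walk s y' z' y].
Proof.
elim: z x => [|a z IH] x /=.
  apply/idP/existsP => [w|[y' /andP[/eqP -> //]]].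
  by exists x; rewrite eqxx.
rewrite IH; apply/andP/existsP => [[ax /existsP[y' /andP[w w']]]|].
  by exists y'; rewrite ax w.
move=> [y' /andP[/andP[-> w] w']]; split => //.
by apply/existsP; exists y'; rewrite w.
Qed.

(** A step sequence determines its endpoint, written here with [last], so the mass at [z0] is a
    single product of rank probabilities. This makes coincidences of light trajectories rare. *)
Lemma qexp_point s m x (z0 : seq step) G :
  (forall z y, 0 <= G z y) ->
  qexp s m x (fun z y => (z == z0)%:R * G z y) <=
  wt z0 * (if walk s x z0 (last x (map (fun a => s a.1 a.2) z0))
           then G z0 (last x (map (fun a => s a.1 a.2) z0)) else 0).
Proof.
move=> G0; elim: m x z0 G G0 => [|m IH] x z0 G G0 /=.
  case: z0 => [|a z0] /=; first by rewrite eqxx wt_nil !mul1r.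
  rewrite mul0r mulr_ge0 ?wt_ge0 //; by case: ifP.
case: z0 => [|a z0] /=.
  rewrite big1 ?wt_nil ?mul1r ?eqxx // => j _.
  by rewrite (@eq_qexp _ _ _ _ (fun _ _ => 0)) ?qexp_cst ?mulr0 // => *;
    rewrite mul0r.
case: eqP => [<-|/eqP ax] /=.
  rewrite (bigD1 a.2) //= big1 ?addr0 => [|j ja].
    rewrite wt_cons -mulrA ler_wpM2l //.
    rewrite -!surjective_pairing (@eq_qexp _ _ _ _ (fun z y => (z == z0)%:R * G
      (a :: z) y)).
      exact: (IH _ _ (fun z => G (a :: z))).
    by move=> z y _ _; rewrite eqseq_cons eqxx.
  rewrite (@eq_qexp _ _ _ _ (fun _ _ => 0)) ?qexp_cst ?mulr0 // => z y _ _.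
  rewrite eqseq_cons [a in _ == a]surjective_pairing xpair_eqE (negbTE ja) andbF.
  by rewrite mul0r.
rewrite mulr0 big1 // => j _.
rewrite (@eq_qexp _ _ _ _ (fun _ _ => 0)) ?qexp_cst ?mulr0 // => z y _ _.
rewrite eqseq_cons [a in _ == a]surjective_pairing xpair_eqE.
by rewrite eq_sym (negbTE ax) mul0r.
Qed.

Lemma lookupP E a y : lookup E a = Some y -> (a, y) \in E.
Proof.
rewrite /lookup; elim: E => //= [[b y'] E] IH /=.
case: eqP => [->|_] /=; first by case=> ->; rewrite inE eqxx.
by move=> /IH; rewrite inE => ->; rewrite orbT.
Qed.

Lemma lookupN E a : (lookup E a == None) = (a \notin dom E).
Proof.
rewrite /lookup; elim: E => //= [[b y] E] IH /=; rewrite inE [a == b]eq_sym.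
by case: (b == a).
Qed.

Lemma mem_dom E a y : (a, y) \in E -> a \in dom E.
Proof. by move=> aE; apply/mapP; exists (a, y). Qed.

Lemma consistentP s E a y : consistent s E -> (a, y) \in E -> s a.1 a.2 = y.
Proof. by move=> /allP sE /sE /eqP. Qed.

Definition swap_row (s : env) x (y y' : 'I_n) : env :=
  [ffun x' => if x' == x then (s x' * tperm y y')%g else s x'].

(** Following row [x] by the transposition of [y] and [y'] maps environments that send [(x, j)] to
    [y] injectively into those that send it to [y'], and respects [E] when neither vertex is yet a
    target of row [x]. At least [n - size E] choices of [y'] are available. *)
Lemma cnt_reveal E x j y : (x, j) \notin dom E ->
  (cnt (((x, j), y) :: E) * (n - size E) <= cnt E)%N.
Proof.
move=> xjE; pose used := [seq e.2 | e <- E & e.1.1 == x].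
pose F y' := [set s : env | consistent s (((x, j), y') :: E)]%SET.
have cntF y' : cnt (((x, j), y') :: E) = #|F y'|.
  by apply: eq_card => s; rewrite !inE.
have [yu|yu] := boolP (y \in used).
  suff -> : cnt (((x, j), y) :: E) = 0 by rewrite mul0n.
  apply: eq_card0 => s; rewrite !inE /=.
  apply/negP => /andP[/eqP sxj sE].
  have /mapP[[[x' j'] y']] := yu; rewrite mem_filter /= => /andP[/eqP -> eE] yy'.
  have := consistentP sE eE => /=; rewrite -yy' -sxj => /perm_inj jj'.
  by move: xjE; rewrite -jj' (mem_dom eE).
have leF y' : y' \notin used -> (#|F y| <= #|F y'|)%N.
  move=> y'u; rewrite -(@card_in_imset _ _ (fun s => swap_row s x y y')); last first.
    move=> s s' _ _ /ffunP eqs; apply/ffunP => x'; have := eqs x'; rewrite !ffunE.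
    by case: eqP => // _ /mulIg.
  apply: subset_leq_card; apply/fintype.subsetP => _ /imsetP[s sF ->].
  move: sF; rewrite !inE /= => /andP[/eqP sxj /allP sE].
  rewrite !ffunE eqxx permM sxj tpermL eqxx /=.
  apply/allP => -[[x' j'] z] eE; have /= /eqP sz := sE _ eE; rewrite ffunE.
  case: (x' =P x) => [x'x|_]; last by rewrite sz.
  rewrite permM sz.
  have zu : z \in used.
    by apply/mapP; exists ((x', j'), z) => //; rewrite mem_filter /= eE x'x eqxx.
  by rewrite tpermD ?eqxx //; apply/eqP => yz; [move: yu | move: y'u]; rewrite yz zu.
have szu : (n - size E <= #|[pred y' | y' \notin used]|)%N.
  rewrite leq_subLR -[X in (X <= _)%N](card_ord n) -(cardC (mem used)).
  rewrite leq_add2r (leq_trans (card_size _)) //.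
  by rewrite size_map size_filter count_size.
apply: (leq_trans (leq_mul (leqnn _) szu)); rewrite mulnC -sum_nat_const.
apply: (@leq_trans (\sum_(y' | y' \notin used) #|F y'|)%N).
  by rewrite cntF; apply: leq_sum => y'; exact: leF.
rewrite /cnt -sum1_card (partition_big
  (fun s : env => s x j) xpredT) //= big_mkcond /=.
apply: leq_sum => y' _; case: ifP => // _; rewrite -sum1_card.
rewrite [X in (_ <= X)%N]big_mkcond [X in (X <= _)%N]big_mkcond.
by apply: leq_sum => s _; rewrite !inE /= andbC.
Qed.

Lemma aexp_le m E x H H' :
  (forall z E' y, size z = m -> (size E' <= size E + m)%N -> H z E' y <= H' z E' y) ->
  aexp m E x H <= aexp m E x H'.
Proof.
elim: m E x H H' => [|m IH] E x H H' leH /=; first by apply: leH; rewrite ?addn0.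
apply: ler_sum => j _; apply: ler_wpM2l => //.
case: lookup => [y|].
  apply: IH => z E' y' sz sE; apply: leH; rewrite /= ?sz // (leq_trans sE) //.
  by rewrite addnS.
apply: ler_wpM2l; first by rewrite invr_ge0.
apply: ler_sum => y _; apply: IH => z E' y' sz sE; apply: leH; rewrite /= ?sz //.
by move: sE; rewrite /= addSn addnS.
Qed.

Lemma eq_aexp m E x H H' :
  (forall z E' y, size z = m -> (size E' <= size E + m)%N -> H z E' y = H' z E' y) ->
  aexp m E x H = aexp m E x H'.
Proof.
by move=> eqH; apply/le_anti/andP; split; apply: aexp_le => z E' y sz sE; rewrite eqH.
Qed.

Lemma avg_cst (c : R) : (0 < n)%N -> n%:R^-1 * \sum_(y < n) c = c.
Proof.
move=> n0; rewrite sumr_const card_ord -[c *+ n]mulr_natl mulrA mulVf ?mul1r //.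
by rewrite pnatr_eq0 -lt0n.
Qed.

Lemma aexp_cst m E x c : aexp m E x (fun _ _ _ => c) = c.
Proof.
have n0 : (0 < n)%N by case: (n) x => // -[].
elim: m E x => //= m IH E x; rewrite (eq_bigr (fun j => p x j * c)) => [|j _].
  by rewrite -mulr_suml p_sum1 mul1r.
congr (_ * _); case: lookup => [y|]; first exact: IH.
by under eq_bigr do rewrite IH; rewrite avg_cst.
Qed.

Lemma aexpZ m E x c H :
  aexp m E x (fun z E' y => c * H z E' y) = c * aexp m E x H.
Proof.
elim: m E x H => //= m IH E x H; rewrite mulr_sumr; apply: eq_bigr => j _.
case: lookup => [y|]; first by rewrite IH mulrCA.
under eq_bigr do rewrite IH; rewrite -mulr_sumr; ring.
Qed.

Lemma aexp_ge0 m E x H :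
  (forall z E' y, size z = m -> (size E' <= size E + m)%N -> 0 <= H z E' y) ->
  0 <= aexp m E x H.
Proof. by move=> H0; rewrite -(aexp_cst m E x 0); exact: aexp_le. Qed.

Lemma aexp_le_cst m E x H c :
  (forall z E' y, size z = m -> (size E' <= size E + m)%N -> H z E' y <= c) ->
  aexp m E x H <= c.
Proof. by move=> H0; rewrite -(aexp_cst m E x c); exact: aexp_le. Qed.

(* Conditionally on [m] revealed edges, a new edge lands at a given vertex with
   probability at most [1 / (n - m)], hence the comparison constant. *)
Lemma qexp_anneal (M m : nat) E x
    (G : env -> seq step -> seq edge -> 'I_n -> R) (H : seq step -> seq edge ->
      'I_n -> R) :
  (size E + m <= M)%N -> (M < n)%N -> uniq (dom E) ->
  (forall z E' y, 0 <= H z E' y) ->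
  (forall z E' y, size z = m -> uniq (dom E') -> (size E' <= size E + m)%N ->
     \sum_(s | consistent s E') G s z E' y <= (cnt E')%:R * H z E' y) ->
  \sum_(s | consistent s E) qexp s m x (fun z y => G s z (ext s E z) y) <=
  (n%:R / (n - M)%:R) ^+ m * ((cnt E)%:R * aexp m E x H).
Proof.
move=> EM Mn; have n0 : 0 < n%:R :> R by rewrite ltr0n (leq_ltn_trans _ Mn).
have nM0 : 0 < (n - M)%:R :> R by rewrite ltr0n subn_gt0.
set C := n%:R / (n - M)%:R.
have C1 : 1 <= C by rewrite ler_pdivlMr // mul1r ler_nat leq_subr.
elim: m E x G H EM => [|m IH] E x G H EM uE H0 leGH.
  by rewrite expr0 mul1r /=; apply: leGH; rewrite ?addn0.
rewrite /= exchange_big /= mulrA mulr_sumr; apply: ler_sum => j _.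
rewrite -mulr_sumr [leRHS]mulrCA; apply: ler_wpM2l => //.
(* A revealed rank costs nothing: both chains move to the same vertex, and the spare factor [C] is
   at least 1. *)
case El : lookup => [y|].
  have aE := lookupP El.
  have -> : \sum_(s | consistent s E) qexp s m (s x j)
      (fun z y0 => G s ((x, j) :: z) (ext s (reveal s E (x, j)) z) y0) =
    \sum_(s | consistent s E) qexp s m y (fun z y0 => G s ((x,
      j) :: z) (ext s E z) y0).
    apply: eq_bigr => s sE; rewrite (consistentP sE aE).
    by apply: eq_qexp => z y0 _ _; rewrite /reveal (mem_dom aE).
  rewrite addnS in EM leGH.
  apply: le_trans (IH _ _ (fun s z => G s ((x, j) :: z)) (fun z => H ((x,
    j) :: z)) _ uE _ _) _.
  - exact: ltnW.
  - by move=> z E' y'; exact: H0.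
  - by move=> z E' y' sz uE' sE'; apply: leGH; rewrite /= ?sz ?uE' // leqW.
  rewrite -mulrA ler_wpM2r //; last by rewrite ler_weXn2l.
  by rewrite mulr_ge0 ?ler0n // aexp_ge0.
have aE : (x, j) \notin dom E by rewrite -lookupN El.
rewrite (partition_big (fun s : env => s x j) xpredT) //=.
rewrite [leRHS]mulrCA !mulr_sumr; apply: ler_sum => y _.
have -> : \sum_(s | consistent s E && (s x j == y)) qexp s m (s x j)
      (fun z y0 => G s ((x, j) :: z) (ext s (reveal s E (x, j)) z) y0) =
    \sum_(s | consistent s (((x, j), y) :: E)) qexp s m y
      (fun z y0 => G s ((x, j) :: z) (ext s (((x, j), y) :: E) z) y0).
  apply: eq_big => [s|s /andP[_ /eqP sxj]]; first by rewrite /= andbC.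
  by rewrite /reveal (negbTE aE) /= sxj.
apply: le_trans (IH _ _ (fun s z => G s ((x, j) :: z)) (fun z => H ((x,
  j) :: z)) _ _ _ _) _.
- by rewrite /= addSn -addnS.
- by rewrite /= aE uE.
- by move=> z E' y'; exact: H0.
- move=> z E' y' sz uE' sE'; apply: leGH; rewrite /= ?sz ?uE' //.
  by move: sE'; rewrite /= addSn addnS.
rewrite exprS mulrA [in leLHS]mulrA; apply: ler_wpM2r; first exact: aexp_ge0.
rewrite [leRHS](_ : _ = C ^+ m * (C * n%:R^-1 * (cnt E)%:R)); last by ring.
apply: ler_wpM2l; first by rewrite exprn_ge0 // (le_trans _ C1).
(* [cnt_reveal] bounds the conditional probability of each target by [1 / (n - M)], which is the
   annealed [1 / n] times [C]. *)
have -> : C * n%:R^-1 = (n - M)%:R^-1 by rewrite /C mulrAC divff ?gt_eqF // mul1r.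
rewrite mulrC ler_pdivlMr // -natrM ler_nat.
apply: leq_trans (cnt_reveal y aE); rewrite leq_mul2l.
by rewrite leq_sub2l ?orbT // (leq_trans _ EM) // leq_addr.
Qed.

End Exploration.

(** * Tree excess of the revealed graph *)

Section Excess.
Variables (n : nat).

Local Notation step := ('I_n * 'I_n)%type.
Local Notation edge := ('I_n * 'I_n * 'I_n)%type.
Local Notation env := {ffun 'I_n -> 'S_n}.

Implicit Types (s : env) (E : seq edge) (z : seq step) (x y i : 'I_n) (a b : step).

Definition seen i E : seq 'I_n := i :: map snd E.

(* The tree excess of the revealed graph, rooted at [i]. *)
Fixpoint excess i E : nat :=
  if E is e :: E' then ((e.2 \in seen i E') + excess i E')%N else 0%N.

(** The most recent edge is at the head. Under this condition the revealed graph is connected to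
    [i], so [excess] is its number of independent cycles. *)
Fixpoint rooted i E : bool :=
  if E is e :: E' then [&& e.1.1 \in seen i E', e.1 \notin dom E' & rooted i E']
  else true.

Lemma consistent_reveal s E a : consistent s E -> consistent s (reveal s E a).
Proof. by rewrite /reveal; case: ifP => //= _ ->; rewrite eqxx. Qed.

Lemma consistent_ext s E z : consistent s E -> consistent s (ext s E z).
Proof. by elim: z E => //= a z IH E sE; apply: IH; exact: consistent_reveal. Qed.

Lemma excess_reveal s i E a : (excess i E <= excess i (reveal s E a))%N.
Proof. by rewrite /reveal; case: ifP => //= _; exact: leq_addl. Qed.

Lemma excess_ext s i E z : (excess i E <= excess i (ext s E z))%N.
Proof.
elim: z E => //= a z IH E; exact: leq_trans (excess_reveal _ _ _ _) (IH _).
Qed.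

Lemma size_reveal s E a : (size E <= size (reveal s E a) <= (size E).+1)%N.
Proof. by rewrite /reveal; case: ifP => //=; rewrite leqnn leqnSn. Qed.

Lemma size_ext s E z : (size E <= size (ext s E z) <= size E + size z)%N.
Proof.
elim: z E => [|a z IH] E /=; first by rewrite addn0 leqnn.
have /andP[h1 h2] := size_reveal s E a.
have /andP[h3 h4] := IH (reveal s E a).
by rewrite (leq_trans h1 h3) (leq_trans h4) // addnS -addSn leq_add2r.
Qed.

Lemma dom_reveal s E a b : (b \in dom (reveal s E a)) = (b == a) || (b \in dom E).
Proof.
rewrite /reveal; case: ifP => //= aE.
by case: eqP => // ->.
Qed.

Lemma dom_ext s E z b : (b \in dom (ext s E z)) = (b \in z) || (b \in dom E).
Proof.
elim: z E => [|a z IH] E //=; rewrite IH dom_reveal inE.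
by case: (b == a); case: (b \in z).
Qed.

Lemma seen_target s i E a : consistent s E -> a \in dom E -> s a.1 a.2 \in seen i E.
Proof.
move=> sE /mapP[[b y] eE /= ->]; rewrite (consistentP sE eE) inE.
by apply/orP; right; apply/mapP; exists (b, y).
Qed.

Lemma seen_next s i E a : consistent s E -> s a.1 a.2 \in seen i (reveal s E a).
Proof.
move=> sE; apply: seen_target; first exact: consistent_reveal.
by rewrite dom_reveal eqxx.
Qed.

Lemma rooted_reveal s i E a :
  rooted i E -> a.1 \in seen i E -> rooted i (reveal s E a).
Proof. by rewrite /reveal => iE xE; case: ifP => //= ->; rewrite xE iE. Qed.

Lemma rooted_ext s i E x z y :
  consistent s E -> rooted i E -> x \in seen i E -> walk s x z y ->
  rooted i (ext s E z) && (y \in seen i (ext s E z)).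
Proof.
elim: z E x => [|a z IH] E x sE iE xE /=; first by move=> /eqP <-; rewrite iE xE.
move=> /andP[/eqP ax w]; rewrite -ax in xE.
apply: IH w; [exact: consistent_reveal|exact: rooted_reveal|exact: seen_next].
Qed.

Lemma rooted_source i E a : rooted i E -> a \in dom E -> a.1 \in seen i E.
Proof.
elim: E => //= e E IH /and3P[eE _ iE]; rewrite inE => /orP[/eqP ->|aE].
  by move: eE; rewrite !inE => /orP[->|->]; rewrite ?orbT.
by have := IH iE aE; rewrite !inE => /orP[->|->]; rewrite ?orbT.
Qed.

Definition usable (e0 : option step) E a := (a \in dom E) && (Some a != e0).

(** Apart from one exceptional edge [e0], the revealed graph is an arborescence with depth function
    [dep]. An edge that closes a cycle becomes [e0], which happens at most once; any other new edge
    reaches a new vertex, whose depth is then set. *)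
Lemma excess1_arborescence s i E :
  consistent s E -> rooted i E -> (excess i E <= 1)%N ->
  exists (dep : 'I_n -> nat) (e0 : option step),
    [/\ dep i = 0%N,
        forall a, usable e0 E a -> dep (s a.1 a.2) = (dep a.1).+1,
        forall a b, usable e0 E a -> usable e0 E b ->
          s a.1 a.2 = s b.1 b.2 -> a = b
      & excess i E = 0%N -> e0 = None].
Proof.
elim: E => [|[a y] E IH] /=; first by move=> _ _ _; exists (fun=> 0%N), None; split.
move=> /andP[/eqP /= ay sE] /and3P[/= aV aE iE] exE.
have [dep [e0 [di dS inj e0N]]] := IH sE iE (leq_trans (leq_addl _ _) exE).
have [yV|yV] := boolP (y \in seen i E).
  have e0E : e0 = None by apply: e0N; move: exE; rewrite yV; case: excess.
  subst e0; exists dep, (Some a); split=> //; rewrite /usable ?yV //=.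
    move=> b; rewrite inE => /andP[/orP[/eqP ->|bE]]; first by rewrite eqxx.
    by move=> _; apply: dS; rewrite /usable bE.
  move=> b c; rewrite !inE => /andP[/orP[/eqP ->|bE]]; first by rewrite eqxx.
  move=> _ /andP[/orP[/eqP ->|cE]]; first by rewrite eqxx.
  by move=> _; apply: inj; rewrite /usable ?bE ?cE.
have old b : usable e0 ((a, y) :: E) b -> b != a -> usable e0 E b.
  by rewrite /usable inE => /andP[/orP[/eqP ->|-> ->] //]; rewrite eqxx.
have ny x : x \in seen i E -> (x == y) = false.
  by move=> xE; apply: contraNF yV => /eqP <-.
exists (fun x => if x == y then (dep a.1).+1 else dep x), e0; split.
- by rewrite ny // inE eqxx.
- move=> b bU; have [->|ba] := eqVneq b a; first by rewrite ay eqxx ny.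
  have bU' := old b bU ba; have /andP[bE _] := bU'.
  by rewrite !ny ?dS // ?seen_target // ?rooted_source.
- move=> b c bU cU; have [->|ba] := eqVneq b a; have [->|ca] := eqVneq c a => //.
  + have /andP[cE _] := old c cU ca; rewrite ay => yc.
    by move: yV; rewrite yc seen_target.
  + have /andP[bE _] := old b bU ba; rewrite ay => yc.
    by move: yV; rewrite -yc seen_target.
  + by apply: inj; exact: old.
- by move=> /eqP; rewrite addn_eq0 => /andP[_ /eqP /e0N].
Qed.

Lemma walk_rcons s x z a y :
  walk s x (rcons z a) y = walk s x z a.1 && (s a.1 a.2 == y).
Proof.
elim: z x => [|b z IH] x /=; first by rewrite eq_sym.
by rewrite IH andbA.
Qed.

Section Uniqueness.
Variables (s : env) (E : seq edge) (i : 'I_n) (dep : 'I_n -> nat) (e0 : option step).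
Hypothesis dep_root : dep i = 0%N.
Hypothesis dep_next : forall a, usable e0 E a -> dep (s a.1 a.2) = (dep a.1).+1.
Hypothesis inj_next : forall a b, usable e0 E a -> usable e0 E b ->
  s a.1 a.2 = s b.1 b.2 -> a = b.

Let uses z := has (fun a => Some a == e0) z.

Lemma dep_walk x z y : walk s x z y -> all (fun a => a \in dom E) z -> ~~ uses z ->
  dep y = (dep x + size z)%N.
Proof.
elim: z x => [|a z IH] x /=; first by move=> /eqP ->; rewrite addn0.
move=> /andP[/eqP ax w] /andP[aE zE]; rewrite negb_or => /andP[ae0 ze0].
by rewrite (IH _ w zE ze0) dep_next ?/usable ?aE // ax addSnnS.
Qed.

Lemma last_use x z y : walk s x z y -> uses z ->
  exists a z1 z2, [/\ z = z1 ++ a :: z2, Some a = e0, ~~ uses z2, walk s x z1 a.1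
    & walk s (s a.1 a.2) z2 y].
Proof.
elim: z x => //= a z IH x /andP[/eqP ax w].
have [zu _|zu /=] := boolP (uses z).
  have [b [z1 [z2 [-> be0 z2u w1 w2]]]] := IH _ w zu.
  by exists b, (a :: z1), z2; split=> //=; rewrite {1}ax eqxx.
rewrite orbF => /eqP ae0.
by exists a, [::], z; split=> //=; rewrite ax.
Qed.

Lemma first_use x z y : walk s x z y -> uses z ->
  exists a z1 z2, [/\ z = z1 ++ a :: z2, Some a = e0, ~~ uses z1 & walk s x z1 a.1].
Proof.
elim: z x => //= a z IH x /andP[/eqP ax w].
have [/eqP ae0 _|ae0 /= zu] := boolP (Some a == e0).
  by exists a, [::], z; split=> //=; rewrite ax.
have [b [z1 [z2 [-> be0 z1u w1]]]] := IH _ w zu.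
exists b, (a :: z1), z2; split=> //=; first by rewrite (negbTE ae0).
by rewrite {1}ax eqxx.
Qed.

(* The first use of [e0] occurs at a fixed time, the depth of its source; a walk
   back to that source which has used [e0] is therefore longer. *)
Lemma uses_source z z' a : Some a = e0 -> walk s i z a.1 -> walk s i z' a.1 ->
  all (fun b => b \in dom E) z -> all (fun b => b \in dom E) z' ->
  size z = size z' -> uses z -> uses z'.
Proof.
move=> ae0 w w' zE z'E szz' uz; apply/negPn/negP => uz'.
have [b [z1 [z2 [zz be0 uz1 w1]]]] := first_use w uz.
have ba : b = a by move: be0; rewrite -ae0 => -[].
move: zE; rewrite zz all_cat => /andP[z1E _].
have := dep_walk w' z'E uz'; rewrite -ba (dep_walk w1 z1E uz1) !dep_root -szz' zz.
by rewrite size_cat /=; lia.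
Qed.

(** Read the walks backwards from [y]. At most one usable edge enters each vertex, so the walks can
    separate only where exactly one of them takes [e0]; the other one then cannot have used [e0] at
    all, against the equality of [uses]. *)
Lemma unique_walk z z' y : walk s i z y -> walk s i z' y ->
  all (fun b => b \in dom E) z -> all (fun b => b \in dom E) z' ->
  size z = size z' -> uses z = uses z' -> z = z'.
Proof.
elim/last_ind: z z' y => [|z a IH] z' y; first by case: z'.
case/lastP: z' => [|z' b]; first by rewrite size_rcons.
rewrite !walk_rcons !all_rcons !size_rcons /uses !has_rcons -/uses.
move=> /andP[w /eqP ay] /andP[w' /eqP b_y] /andP[aE zE] /andP[bE z'E] [szz'].
have [ab|ab] := eqVneq a b.
  rewrite -{}ab in b_y w' bE * => uzz'; congr rcons; apply: (IH _ _ w w' zE z'E szz').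
  move: uzz'; have [/eqP ae0 _|_] := boolP (Some a == e0) => //.
  by apply/idP/idP; [apply: (uses_source ae0 w w')|apply: (uses_source ae0 w' w)].
(* After its last use of [e0] the walk [u] only gains depth, so it cannot come back through [d] to
   the endpoint of [e0]. *)
have no_return c d u : Some c = e0 -> Some d != e0 -> c != d -> d \in dom E ->
    s c.1 c.2 = s d.1 d.2 -> walk s i u d.1 -> all (fun b => b \in dom E) u ->
    ~~ uses u.
  move=> ce0 de0 cd dE cdE wu uE; apply/negP => uu.
  have [f [u1 [u2 [uu12 fe0 u2u w1 w2]]]] := last_use wu uu.
  have fc : f = c by move: fe0; rewrite -ce0 => -[].
  move: uE; rewrite uu12 all_cat /= => /and3P[_ _ u2E].
  have := dep_walk w2 u2E u2u; rewrite fc cdE (dep_next (a := d)) /usable ?dE //.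
  by move/eqP; rewrite addSnnS -[X in X == _]addn0 eqn_add2l.
have [ae0|ae0] := boolP (Some a == e0); have [be0|be0] := boolP (Some b == e0) => /=.
- by move: ab; rewrite -(eqP be0) in ae0; move: ae0 => /eqP[->]; rewrite eqxx.
- move=> /esym uz'; have := no_return a b z' (eqP ae0) be0 ab bE.
  by rewrite [uses z']uz' ay b_y => /(_ erefl w' z'E).
- move=> uz; have := no_return b a z (eqP be0) ae0.
  by rewrite eq_sym ab [uses z]uz ay b_y => /(_ erefl aE erefl w zE).
- have := @inj_next a b; rewrite /usable aE bE ae0 be0 ay b_y => /(_ erefl erefl
  erefl).
  by move=> e; move: ab; rewrite e eqxx.
Qed.

End Uniqueness.

(** With excess at most 1, a walk from [i] of given length and endpoint would be determined by
    whether it uses [e0], and two of the three walks agree in that respect. *)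
Lemma three_walks_excess s i z1 z2 z3 y :
  walk s i z1 y -> walk s i z2 y -> walk s i z3 y ->
  size z1 = size z2 -> size z2 = size z3 -> uniq [:: z1; z2; z3] ->
  (1 < excess i (ext s (ext s (ext s [::] z1) z2) z3))%N.
Proof.
move=> w1 w2 w3 sz12 sz23 uz; rewrite ltnNge; apply/negP => ex1.
pose E1 := ext s [::] z1; pose E2 := ext s E1 z2; set E3 := ext s _ z3 in ex1.
have s1 : consistent s E1 by exact: consistent_ext.
have s2 : consistent s E2 by exact: consistent_ext.
have s3 : consistent s E3 by exact: consistent_ext.
have iseen E : i \in seen i E by rewrite inE eqxx.
have /andP[r1 _] := rooted_ext (isT : consistent s [::]) (isT : rooted i [::])
  (iseen _) w1.
have /andP[r2 _] := rooted_ext s1 r1 (iseen _) w2.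
have /andP[r3 _] := rooted_ext s2 r2 (iseen _) w3.
have [dep [e0 [di dS inj _]]] := excess1_arborescence s3 r3 ex1.
have z1E : all (fun b => b \in dom E3) z1.
  by apply/allP => b bz; rewrite !dom_ext bz !orbT.
have z2E : all (fun b => b \in dom E3) z2.
  by apply/allP => b bz; rewrite !dom_ext bz !orbT.
have z3E : all (fun b => b \in dom E3) z3.
  by apply/allP => b bz; rewrite !dom_ext bz.
have U := unique_walk di dS inj.
have U12 := U _ _ _ w1 w2 z1E z2E sz12.
have U13 := U _ _ _ w1 w3 z1E z3E (etrans sz12 sz23).
have U23 := U _ _ _ w2 w3 z2E z3E sz23.
move: uz; rewrite /= !inE negb_or andbT => /andP[/andP[/eqP n12 /eqP n13] /eqP n23].
move: U12 U13 U23.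
case: (has _ z1); case: (has _ z2); case: (has _ z3) => U12 U13 U23.
all: by [case: n12; exact: U12|case: n13; exact: U13|case: n23; exact: U23].
Qed.

End Excess.

(** * Looping walks *)

Section Looping.
Variables (R : realType) (n : nat) (p : 'M[R]_n).
Hypothesis p_ge0 : forall i j, 0 <= p i j.
Hypothesis p_sum1 : forall i, \sum_j p i j = 1.

Local Notation step := ('I_n * 'I_n)%type.
Local Notation edge := ('I_n * 'I_n * 'I_n)%type.
Local Notation env := {ffun 'I_n -> 'S_n}.

Implicit Types (E : seq edge) (z : seq step) (x y : 'I_n) (a b : step).

Variables (s : env) (i : 'I_n) (N : nat) (r : R).
Hypothesis r_ge0 : 0 <= r.
Hypothesis r_le1 : r <= 1.
Hypothesis closed_wt : forall y z, walk s y z y -> (0 < size z <= N)%N ->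
  uniq (map fst z) -> wt p z <= r.

(** The last step whose source recurs later starts a closed walk with distinct sources, and the
    remaining factors of the weight are at most 1. *)
Lemma repeat_wt x z y :
  walk s x z y -> (size z <= N)%N -> ~~ uniq (map fst z) -> wt p z <= r.
Proof.
elim: z x => //= a z IH x /andP[_ w] szN; rewrite negb_and negbK.
have [uz|uz _] := boolP (uniq (map fst z)); last first.
  rewrite wt_cons; apply: le_trans (IH _ w (ltnW szN) uz).
  by rewrite ler_piMl ?wt_ge0 ?p_le1.
rewrite orbF => /mapP[b bz ab]; case/path.splitPr: bz szN uz w => z1 z2 szN uz.
rewrite walk_cat => /existsP[y' /andP[w1 /= /andP[/eqP by' _]]].
apply: (@le_trans _ _ (wt p (a :: z1))).
  by rewrite -cat_cons wt_cat ler_piMr ?wt_ge0 ?wt_le1.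
rewrite -by' -ab in w1; apply: (@closed_wt a.1) => /=; first by rewrite eqxx.
  by apply: leq_trans szN; rewrite size_cat /= ltnS leq_addr.
by rewrite ab; move: uz; rewrite map_cat cat_uniq /= => /and3P[-> /norP[->]].
Qed.

Definition short E z (_ : 'I_n) : R :=
  ((excess i (ext s E z) <= 1) && (size (ext s E z) < N))%N%:R.

Lemma short_le1 E z y : short E z y <= 1.
Proof. by rewrite /short lern1 leq_b1. Qed.

Lemma short_big E z y : (N <= size E)%N -> short E z y = 0.
Proof.
move=> NE; rewrite /short ltnNge (leq_trans NE) ?andbF //.
by case/andP: (size_ext s E z).
Qed.

Lemma short_excess E z y : (1 < excess i E)%N -> short E z y = 0.
Proof.
by move=> ex; rewrite /short leqNgt (leq_trans ex) ?excess_ext.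
Qed.

Definition sources E : seq 'I_n := map fst (dom E).

(** From a vertex without revealed outgoing edge the next edge is new. It either hits a seen vertex,
    which adds a cycle to the existing one, or reaches a new vertex, which again has no revealed
    outgoing edge. *)
Lemma fresh_run E x z y :
  consistent s E -> rooted i E -> (0 < excess i E)%N ->
  x \in seen i E -> x \notin sources E -> walk s x z y ->
  (1 < excess i (ext s E z))%N \/ size (ext s E z) = (size E + size z)%N.
Proof.
elim: z E x => [|a z IH] E x sE iE ex xE xN /=; first by rewrite addn0; right.
move=> /andP[/eqP ax w]; have aE : a \notin dom E.
  by apply: contra xN => aE; rewrite -ax; exact: map_f.
have [tE|tE] := boolP (s a.1 a.2 \in seen i E).
  left; apply: leq_trans (excess_ext _ _ _ _).
  by rewrite /reveal (negbTE aE) /= tE.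
have EE' : reveal s E a = (a, s a.1 a.2) :: E by rewrite /reveal (negbTE aE).
rewrite -addSnnS -[(size E).+1]/(size ((a, s a.1 a.2) :: E)) -EE'.
apply: IH w.
- exact: consistent_reveal.
- by rewrite rooted_reveal // ax.
- exact: leq_trans ex (excess_reveal _ _ _ _).
- exact: seen_next.
- rewrite /sources EE' /= inE negb_or.
  apply/andP; split; first by apply: contraNneq tE => ->; rewrite ax.
  by apply: contra tE => /mapP[b bE ->]; exact: rooted_source bE.
Qed.

(** A walk that stays in such a revealed graph is forced at every step. *)
Definition deterministic E : Prop :=
  {in dom E &, forall a b, a.1 = b.1 -> a = b}.

Section Loop.
Variable E : seq edge.
Hypotheses (sE : consistent s E) (iE : rooted i E).
Hypotheses (exE : (0 < excess i E)%N) (dE : deterministic E).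

(** Leaving a revealed graph that already has a cycle creates a second one or starts a run of at
    least [N] new edges, by [fresh_run]. *)
Lemma short_leave m x z y : x \in seen i E -> (N <= m)%N -> size z = m ->
  walk s x z y -> (forall a z', z = a :: z' -> a \notin dom E) -> short E z y = 0.
Proof.
case: z => [|a z] /= xE Nm sz; first by rewrite short_big // (leq_trans Nm) // -sz.
move=> /andP[/eqP ax w] /(_ a z erefl) aE.
have [tE|tE] := boolP (s a.1 a.2 \in seen i E).
  suff : (1 < excess i (reveal s E a))%N by move/(short_excess z y).
  by rewrite /reveal (negbTE aE) /= tE.
have [|||||||] := @fresh_run (reveal s E a) (s a.1 a.2) z y => //.
- exact: consistent_reveal.
- by rewrite rooted_reveal // ax.
- exact: leq_trans exE (excess_reveal _ _ _ _).
- exact: seen_next.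
- rewrite /sources /reveal (negbTE aE) /= inE negb_or.
  apply/andP; split; first by apply: contraNneq tE => ->; rewrite ax.
  by apply: contra tE => /mapP[b bE ->]; exact: rooted_source bE.
- by rewrite /short /= => ex; rewrite leqNgt ex.
- rewrite /short /= => ->; rewrite /reveal (negbTE aE) /= ltnNge.
  by rewrite addSnnS sz (leq_trans Nm) ?leq_addl // andbF.
Qed.

(** Steps out of the revealed graph contribute nothing, so the first [l] steps follow the forced
    walk [z] and its weight comes out as a factor. The first alternative covers a forced walk that
    gets stuck. *)
Lemma loop_step m x l : x \in seen i E -> (N <= m)%N ->
  qexp p s (l + m) x (short E) <= 0 \/
  exists z y, [/\ size z = l, walk s x z y, all (fun a => a \in dom E) z,
    y \in seen i E & qexp p s (l + m) x (short E) <= wt p z * qexp p s m y (short E)].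
Proof.
move=> + Nm; elim: l x => [|l IH] x xE.
  by right; exists [::], x; rewrite wt_nil mul1r /= eqxx.
rewrite addSn /=.
have out j : (x, j) \notin dom E ->
    qexp p s (l + m) (s x j) (fun z => short E ((x, j) :: z)) = 0.
  move=> xjE; rewrite -(qexp_cst p_sum1 s (l + m) (s x j) 0).
  apply: eq_qexp => // z y sz w; apply: (@short_leave (l + m).+1 x);
    rewrite //= ?sz //.
  - by rewrite leqW // (leq_trans Nm) ?leq_addl.
  - by rewrite eqxx.
  - by move=> a z' [<- _].
have [/existsP[j xjE]|/existsPn nE] := boolP [exists j, (x, j) \in dom E]; last first.
  by left; rewrite big1 // => j _; rewrite out ?mulr0.
rewrite (bigD1 j) //= big1 ?addr0 => [|k kj]; last first.
  rewrite out ?mulr0 //; apply: contra kj => xkE.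
  by have [->] := dE xkE xjE erefl.
have -> : qexp p s (l + m) (s x j) (fun z => short E ((x, j) :: z)) =
    qexp p s (l + m) (s x j) (short E).
  by apply: eq_qexp => // z y _ _; rewrite /short /= /reveal xjE.
have [q0|[z [y [sz w zE yE qE]]]] := IH (s x j) (seen_target _ sE xjE).
  by left; rewrite mulr_ge0_le0.
right; exists ((x, j) :: z), y; split; rewrite //= ?sz ?eqxx ?xjE //.
by rewrite wt_cons -mulrA ler_wpM2l.
Qed.

(** Fewer than [N] edges are revealed, so [N] forced steps repeat a source and contain a closed
    walk; each such block costs a factor [r]. *)
Lemma loop_bound K m x : x \in seen i E -> (N <= m)%N -> (size E < N)%N ->
  qexp p s (K * N + m) x (short E) <= r ^+ K.
Proof.
move=> + Nm EN; elim: K x => [|K IH] x xE.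
  rewrite expr0 -(qexp_cst p_sum1 s (0 * N + m) x 1).
  by apply: qexp_le => // z y _ _; exact: short_le1.
rewrite mulSn -addnA.
have NKm : (N <= K * N + m)%N by rewrite (leq_trans Nm) ?leq_addl.
have [q0|[z [y [sz w zE yE qE]]]] := loop_step N xE NKm.
  by rewrite (le_trans q0) // exprn_ge0.
rewrite (le_trans qE) // exprS ler_pM ?wt_ge0 ?IH //.
  by apply: qexp_ge0 => // *; rewrite /short ler0n.
apply: repeat_wt w _ _; rewrite ?sz //; apply/negP => uz.
have /uniq_leq_size := uz => /(_ (sources E)).
have sub : {subset map fst z <= sources E}.
  by move=> _ /mapP[a az ->]; apply: map_f; exact: (allP zE).
by move/(_ sub); rewrite !size_map sz leqNgt EN.
Qed.

End Loop.

(** As long as there is no cycle, every step reveals an edge. So either [N] edges get revealed, and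
    [short] vanishes, or the first cycle closes before that and [loop_bound] applies to the
    remaining steps. *)
Lemma short_bound K E m x :
  consistent s E -> rooted i E -> excess i E = 0%N -> deterministic E ->
  x \in seen i E -> x \notin sources E -> (size E + m)%N = (K.+2 * N)%N ->
  qexp p s m x (short E) <= r ^+ K.
Proof.
elim: m E x => [|m IH] E x sE iE ex dE xE xN Em.
  by rewrite /= short_big ?exprn_ge0 // -[size E]addn0 Em leq_pmull.
rewrite /= -[leRHS]mul1r -(p_sum1 x) mulr_suml; apply: ler_sum => j _.
apply: ler_wpM2l => //; set E' := ((x, j), s x j) :: E.
have xjE : (x, j) \notin dom E by apply: contra xN => xjE; exact: (map_f fst xjE).
have EE' : reveal s E (x, j) = E' by rewrite /reveal (negbTE xjE).
have -> : qexp p s m (s x j) (fun z => short E ((x, j) :: z)) =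
    qexp p s m (s x j) (short E').
  by apply: eq_qexp => // z y _ _; rewrite /short /= EE'.
have sE' : consistent s E' by rewrite -EE' consistent_reveal.
have iE' : rooted i E' by rewrite -EE' rooted_reveal.
have dE' : deterministic E'.
  move=> a b; rewrite /= !inE => /orP[/eqP ->|aE] /orP[/eqP ->|bE] //= => [xb|ax|].
  - by move: xN; rewrite xb map_f.
  - by move: xN; rewrite -ax map_f.
  - exact: dE.
have tE' : s x j \in seen i E' by rewrite -EE' (seen_next i (x, j) sE).
have [tE|tE] := boolP (s x j \in seen i E).
  have [E'N|NE'] := ltnP (size E') N.
    (* More than [K.+1 * N] steps remain: [K * N] for the turns, and at least [N] to make any exit
       from the loop fatal. *)
    have [m' mE m'N] : exists2 m', m = (K * N + m')%N & (N <= m')%N.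
      exists (m - K * N)%N; last first.
        by rewrite -(leq_add2l (K * N)) subnKC; move: E'N Em; rewrite /=; nia.
      by rewrite subnKC //; move: E'N Em; rewrite /=; nia.
    rewrite mE loop_bound //= ?tE //.
  rewrite -(qexp_cst p_sum1 s m (s x j) (r ^+ K)).
  by apply: qexp_le => // z y _ _; rewrite short_big ?exprn_ge0.
apply: IH => //=.
- by rewrite (negbTE tE) ex.
- rewrite inE negb_or; apply/andP; split; first by apply: contraNneq tE => ->.
  by apply: contra tE => /mapP[b bE ->]; exact: rooted_source bE.
- by rewrite addSnnS.
Qed.

End Looping.

(** * Annealed estimates *)

Definition mean (R : realType) (n : nat) (f : 'I_n -> R) : R :=
  n%:R^-1 * \sum_y f y.

Section Annealed.
Variables (R : realType) (n : nat) (p : 'M[R]_n).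
Hypothesis p_ge0 : forall i j, 0 <= p i j.
Hypothesis p_sum1 : forall i, \sum_j p i j = 1.
Variable M : nat.
Hypothesis n_gt0 : (0 < n)%N.

Local Notation step := ('I_n * 'I_n)%type.
Local Notation edge := ('I_n * 'I_n * 'I_n)%type.

Implicit Types (E : seq edge) (z : seq step) (x y i : 'I_n) (a b : step).


(* A new edge lands at one of at most [M.+1] given vertices with probability at
   most [c]. *)
Let c : R := M.+1%:R / n%:R.

Let c_ge0 : 0 <= c. Proof. by rewrite divr_ge0. Qed.

Lemma mean_le (f g : 'I_n -> R) : (forall y, f y <= g y) -> mean f <= mean g.
Proof.
by move=> fg; rewrite /mean ler_wpM2l ?invr_ge0 ?ler0n // ler_sum.
Qed.

Lemma mean_mem (S : seq 'I_n) : (size S <= M.+1)%N ->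
  mean (fun y => (y \in S)%:R) <= c.
Proof.
move=> SM; rewrite /mean /c mulrC ler_wpM2r ?invr_ge0 ?ler0n // -natr_sum ler_nat.
apply: leq_trans SM; rewrite -big_mkcond /= sum1_card; exact: card_size.
Qed.

Lemma mean_add (f g : 'I_n -> R) : mean (fun y => f y + g y) = mean f + mean g.
Proof. by rewrite /mean big_split mulrDr. Qed.

Lemma mean_mulr (f : 'I_n -> R) (k : R) : mean (fun y => f y * k) = mean f * k.
Proof. by rewrite /mean -mulr_suml mulrA. Qed.

Lemma mean_const (k : R) : mean (fun _ : 'I_n => k) = k.
Proof. exact: avg_cst. Qed.

Lemma lookup_source E y j : y \notin sources E -> lookup E (y, j) = None.
Proof.
move=> yE; apply/eqP; rewrite lookupN; apply: contra yE => /(map_f fst); exact.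
Qed.

Lemma size_sources E : size (sources E) = size E.
Proof. by rewrite !size_map. Qed.

Section ExcessPotential.
Variable i : 'I_n.

(** A bound for the probability that excess [e] grows to at least 2 within [k] new edges: each
    missing coincidence costs a factor [k * c]. *)
Definition excess_potential (k e : nat) : R :=
  match e with
  | 0 => (k%:R * c) ^+ 2
  | 1 => k%:R * c
  | _ => 1
  end.

Lemma excess_potential_mono k e : excess_potential k e <= excess_potential k.+1 e.
Proof.
case: e => [|[|e]] //=; last by rewrite ler_wpM2r // ler_nat.
by rewrite lerXn2r ?nnegrE ?mulr_ge0 // ler_wpM2r // ler_nat.
Qed.

(** A new edge hits a seen vertex with probability at most [c], and [(k * c)^2 + c * (k * c) <= ((k
    + 1) * c)^2]. *)
Lemma mean_excess_potential k E : (size E <= M)%N ->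
  mean (fun y => excess_potential k ((y \in seen i E) + excess i E)) <=
  excess_potential k.+1 (excess i E).
Proof.
move=> EM; have mem_c : mean (fun y => (y \in seen i E)%:R) <= c.
  by apply: mean_mem; rewrite /= size_map.
case: (excess i E) => [|[|e]].
- apply: (@le_trans _ _ (mean (fun y => (k%:R * c) ^+ 2 +
  (y \in seen i E)%:R * (k%:R * c)))).
    apply: mean_le => y; case: (y \in _) => /=; last by rewrite mul0r addr0.
    by rewrite mul1r lerDr sqr_ge0.
  rewrite mean_add mean_const mean_mulr /=.
  have k0 : 0 <= k%:R :> R by [].
  apply: (@le_trans _ _ ((k%:R * c) ^+ 2 + c * (k%:R * c))).
    by rewrite lerD2l ler_wpM2r // mulr_ge0.
  rewrite -natr1; nra.
- apply: (@le_trans _ _ (mean (fun y => k%:R * c + (y \in seen i E)%:R))).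
    apply: mean_le => y; case: (y \in _) => /=; last by rewrite addr0.
    by rewrite lerDr mulr_ge0.
  rewrite mean_add mean_const /= -natr1 mulrDl mul1r; exact: lerD.
- rewrite (_ : (fun y => _) = fun=> 1) ?mean_const //.
  by apply/funext => y; rewrite !addnS.
Qed.

(** The parameter [k] reserves steps for further walks, so that several explorations can be
    chained. *)
Lemma aexp_excess m k E x : (size E + m <= M)%N ->
  aexp p m E x (fun _ E' _ => excess_potential k (excess i E')) <=
  excess_potential (m + k) (excess i E).
Proof.
elim: m E x => [|m IH] E x EM //; rewrite addSn /=.
rewrite -[leRHS]mul1r -[X in _ <= X * _](p_sum1 x) mulr_suml; apply: ler_sum => j _.
apply: ler_wpM2l => //; case: lookup => [y|].
  apply: le_trans (excess_potential_mono _ _); apply: IH.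
  by rewrite addnS in EM; exact: ltnW.
apply: le_trans (mean_excess_potential _ _); last exact: leq_trans (leq_addr _ _) EM.
apply: mean_le => y; apply: IH => /=.
by rewrite addSnnS.
Qed.

End ExcessPotential.

Section Heavy.
Variable r : nat.
Let q : R := mean (fun y => \sum_j p y j ^+ r.+1) + c.

Let q_ge0 : 0 <= q.
Proof.
rewrite addr_ge0 // mulr_ge0 ?invr_ge0 ?sumr_ge0 // => y _.
by rewrite sumr_ge0 // => j _; rewrite exprn_ge0.
Qed.

Let heavy k z E (_ : 'I_n) : R := wt p z ^+ r * (k <= size E)%N%:R.

Let heavy_cons k a z E y : heavy k (a :: z) E y = p a.1 a.2 ^+ r * heavy k z E y.
Proof. by rewrite /heavy wt_cons exprMn mulrA. Qed.

Let heavy_le1 k z E y : heavy k z E y <= 1.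
Proof.
rewrite /heavy; apply: mulr_ile1; rewrite ?exprn_ge0 ?wt_ge0 //.
  by rewrite exprn_ile1 ?wt_ge0 ?wt_le1.
by rewrite lern1 leq_b1.
Qed.

Let heavy_ge0 k z E y : 0 <= heavy k z E y.
Proof. by rewrite /heavy mulr_ge0 ?exprn_ge0 ?wt_ge0. Qed.

Let aexp_heavy_cons m E x k a :
  aexp p m E x (fun z => heavy k (a :: z)) = p a.1 a.2 ^+ r * aexp p m E x (heavy k).
Proof. by rewrite -aexpZ; apply: eq_aexp => // z E' y _ _; exact: heavy_cons. Qed.

Let aexp_heavy_ge0 m E x k : 0 <= aexp p m E x (heavy k).
Proof. by apply: aexp_ge0. Qed.

(* The bound at a uniformly landed vertex and the bound at an arbitrary vertex
   have to be proved together. *)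
Lemma aexp_heavy_both m :
  (forall E x N, (size E + m <= M)%N ->
     aexp p m E x (heavy (size E + N.+1)) <= q ^+ N) /\
  (forall E a N, (size E + m < M)%N ->
     mean (fun y => aexp p m ((a, y) :: E) y (heavy ((size E).+1 + N))) <= q ^+ N).
Proof.
elim: m => [|m [IHu IHv]].
  split=> [E x N _|E a [|N] _] /=; rewrite /heavy.
  - by rewrite addnS ltnNge leq_addr mulr0 exprn_ge0.
  - rewrite expr0 -[leRHS]mean_const; apply: mean_le => y /=.
    by rewrite wt_nil expr1n mul1r lern1 leq_b1.
  - rewrite -[leRHS]mean_const; apply: mean_le => y /=.
    by rewrite addnS ltnNge leq_addr mulr0 exprn_ge0.
have u E x N : (size E + m.+1 <= M)%N ->
    aexp p m.+1 E x (heavy (size E + N.+1)) <= q ^+ N.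
  move=> EM /=; rewrite -[leRHS]mul1r -[X in _ <= X * _](p_sum1 x) mulr_suml;
    apply: ler_sum => j _.
  apply: ler_wpM2l => //.
  have pr1 : p x j ^+ r <= 1 by rewrite exprn_ile1 ?p_le1.
  case: lookup => [y|].
    rewrite aexp_heavy_cons; apply: le_trans (IHu E y N _);
      last by rewrite ltnW // -addnS.
    by rewrite ler_piMl.
  apply: le_trans (IHv E (x, j) N _); last by rewrite -addnS.
  apply: mean_le => y; rewrite aexp_heavy_cons addSnnS.
  by rewrite ler_piMl.
split=> // E a [|N] EM.
  rewrite expr0 -[leRHS]mean_const; apply: mean_le => y.
  by apply: aexp_le_cst => // *; exact: heavy_le1.
(* A landing in [S] has probability at most [c] and is charged the bound at an arbitrary vertex.
   Elsewhere all ranks are new, and the next edge gains the power sum: [r] factors [p y j] come from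
   the weight and one from the choice of the rank. *)
pose S := a.1 :: sources E.
apply: (@le_trans _ _ (mean (fun y => (y \in S)%:R * q ^+ N +
    (\sum_j p y j ^+ r.+1) * q ^+ N))); last first.
  rewrite mean_add !mean_mulr exprS -mulrDl ler_wpM2r ?exprn_ge0 // addrC lerD2l.
  apply: mean_mem; rewrite /= size_sources ltnS.
  by rewrite ltnW // (leq_trans _ EM) // ltnS leq_addr.
apply: mean_le => y; have [yS|yS] := boolP (y \in S).
  rewrite mul1r (le_trans (u ((a, y) :: E) y N _)) //= ?addSn //.
  by rewrite lerDl mulr_ge0 ?exprn_ge0 // sumr_ge0 // => j _; rewrite exprn_ge0.
rewrite mul0r add0r mulr_suml /=; apply: ler_sum => j _.
rewrite lookup_source; last by rewrite /sources /= in yS *.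
rewrite exprS -mulrA; apply: ler_wpM2l => //.
have := IHv ((a, y) :: E) (y, j) N; rewrite /= addSn -addnS => /(_ EM) => le_v.
apply: (@le_trans _ _ (p y j ^+ r * mean (fun y0 => aexp p m (((y, j), y0) :: (a,
  y) :: E)
     y0 (heavy ((size E).+2 + N))))).
  rewrite /mean mulrCA ler_wpM2l ?invr_ge0 // mulr_sumr; apply: ler_sum => y' _.
  by rewrite aexp_heavy_cons !addSn addnS.
by apply: ler_wpM2l => //; rewrite exprn_ge0.
Qed.

(** The power [r] prepares Markov's inequality: staying heavy while revealing more than [N] edges is
    exponentially unlikely in [N]. *)
Lemma aexp_heavy m x N : (m <= M)%N ->
  aexp p m [::] x (fun z E _ => wt p z ^+ r * (N < size E)%N%:R) <= q ^+ N.
Proof. by move=> mM; have [u _] := aexp_heavy_both m; exact: (u [::]). Qed.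

End Heavy.

Section Closed.
Variable D : 'I_n -> 'I_n -> bool.
Let eta : R := mean (fun y => \sum_j (D y j)%:R).

Definition fresh_in (S : seq 'I_n) (i : 'I_n) z (_ : seq edge) y : R :=
  [&& uniq (map fst z), all (fun a => a.1 \notin S) z, all (fun a => D a.1 a.2) z
    & y == i]%:R.

(** Each source is a new vertex, uniform when reached, and [eta] is the mean number of its ranks in
    [D], choice probabilities being bounded by 1. The final landing at [i] gives the factor
    [1 / n]. *)
Lemma mean_fresh_in m S E a i :
  a.1 \in S -> {subset sources E <= S} ->
  mean (fun y => aexp p m ((a, y) :: E) y (fresh_in S i)) <= eta ^+ m / n%:R.
Proof.
elim: m S E a => [|m IH] S E a aS ES.
  rewrite /mean expr0 mul1r /fresh_in /= -[leRHS]mulr1 ler_wpM2l ?invr_ge0 //.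
  by rewrite (bigD1 i) //= big1 ?eqxx ?addr0 // => y /negbTE ->.
rewrite exprS -mulrA -mean_mulr; apply: mean_le => y.
rewrite /= mulr_suml; apply: ler_sum => j _.
have [yS|yS] := boolP (y \in S).
  have z0 H : (forall z E' y', H z E' y' = fresh_in S i ((y, j) :: z) E' y') ->
      forall E' y', aexp p m E' y' H = 0.
    move=> HE E' y'; rewrite -[RHS](aexp_cst p_sum1 m E' y' 0).
    by apply: eq_aexp => // z E'' y'' _ _; rewrite HE /fresh_in /= yS /= andbF.
  rewrite (_ : (if _ is Some _ then _ else _) = 0) ?mulr0.
    by rewrite mulr_ge0 // divr_ge0 // exprn_ge0 // mulr_ge0 ?invr_ge0 // sumr_ge0 //
      => *; rewrite sumr_ge0.
  case: lookup => [y'|]; first exact: z0.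
  by rewrite big1 ?mulr0 // => y' _; exact: z0.
rewrite lookup_source; last first.
  rewrite /sources /= inE negb_or; apply/andP; split.
    by apply: contraNneq yS => ->.
  by apply: contra yS => /ES.
have [Dyj|Dyj] := boolP (D y j); last first.
  rewrite mul0r big1 ?mulr0 // => y' _;
    rewrite -[RHS](aexp_cst p_sum1 m (((y, j), y') :: (a, y) :: E) y' 0).
  by apply: eq_aexp => // z E'' y'' _ _; rewrite /fresh_in /= (negbTE Dyj) /= !andbF.
rewrite mul1r; apply: le_trans (IH (y :: S) ((a, y) :: E) (y, j) _ _).
- rewrite -[leRHS]mul1r; apply: ler_pM => //.
  + by rewrite mulr_ge0 ?invr_ge0 // sumr_ge0 // => y' _; apply: aexp_ge0.
  + by rewrite p_le1.
  apply: mean_le => y'; apply: aexp_le => // z E' y'' _ _;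
    rewrite /fresh_in /= Dyj yS.
  apply: ler_bool => /and4P[/andP[yz uz] zS /= zD yi].
  rewrite uz zD yi !andbT.
  apply/allP => b bz; rewrite inE negb_or (allP zS b bz) andbT.
  by apply: contraNneq yz => <-; exact: map_f.
- by rewrite inE eqxx.
- move=> x; rewrite /sources /= !inE => /orP[/eqP ->|xE]; first by rewrite aS orbT.
  by rewrite ES ?orbT.
Qed.

End Closed.

End Annealed.

(** * Fluctuations of the weight *)

Section Deviation.
Variables (R : realType) (n : nat) (p : 'M[R]_n).
Hypothesis p_ge0 : forall i j, 0 <= p i j.
Hypothesis p_sum1 : forall i, \sum_j p i j = 1.
Variable M : nat.
Hypothesis n_gt0 : (0 < n)%N.

Local Notation step := ('I_n * 'I_n)%type.
Local Notation edge := ('I_n * 'I_n * 'I_n)%type.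

Implicit Types (E : seq edge) (z : seq step) (x y i : 'I_n) (a b : step).

Let c : R := M.+1%:R / n%:R.

Let c_ge0 : 0 <= c. Proof. by rewrite divr_ge0. Qed.

(* The annealed chain as long as it only meets new vertices: its weights are
   independent with the law of [p y j], [y] uniform. *)
Fixpoint iid (m : nat) (F : seq step -> R) : R :=
  if m is m'.+1 then
    mean (fun y => \sum_j p y j * iid m' (fun z => F ((y, j) :: z)))
  else F [::].

Lemma iid_le m F G : (forall z, size z = m -> F z <= G z) -> iid m F <= iid m G.
Proof.
elim: m F G => [|m IH] F G FG /=; first exact: FG.
apply: mean_le => y; apply: ler_sum => j _; apply: ler_wpM2l => //.
by apply: IH => z sz; apply: FG; rewrite /= sz.
Qed.

Lemma iidZ m k F : iid m (fun z => k * F z) = k * iid m F.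
Proof.
elim: m F => //= m IH F; rewrite /mean [RHS]mulrCA [X in _ = _ * X]mulr_sumr;
  congr (_ * _).
apply: eq_bigr => y _; rewrite mulr_sumr; apply: eq_bigr => j _.
by rewrite IH mulrCA.
Qed.

(** The annealed chain behaves like the independent one until it lands on a vertex whose ranks may
    be partly revealed, which costs at most [c] per step. *)
Lemma mean_aexp_iid m E a (F : seq step -> R) :
  (forall z, 0 <= F z <= 1) -> (size E + m < M.+1)%N ->
  mean (fun y => aexp p m ((a, y) :: E) y (fun z _ _ => F z)) <= m%:R * c + iid m F.
Proof.
elim: m E a F => [|m IH] E a F F01 EM;
  first by rewrite mul0r add0r /= (mean_const n_gt0).
pose S := a.1 :: sources E.
have F1 z : F z <= 1 by case/andP: (F01 z).
have F0 z : 0 <= F z by case/andP: (F01 z).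
apply: (@le_trans _ _ (mean (fun y => (y \in S)%:R + (m%:R * c +
    \sum_j p y j * iid m (fun z => F ((y, j) :: z)))))); last first.
  rewrite !mean_add (mean_const n_gt0);
    rewrite -natr1 mulrDl mul1r addrA [m%:R * c + c]addrC !lerD2r.
  apply: mean_mem; rewrite /= size_sources ltnS.
  by rewrite -ltnS (leq_ltn_trans _ EM) // leq_addr.
have iid0 G : (forall z, 0 <= G z) -> 0 <= iid m G.
  move=> G0; rewrite -(mul0r (iid m G)) -iidZ; apply: iid_le => z _.
  by rewrite mul0r.
apply: mean_le => y; have [yS|yS] := boolP (y \in S).
  apply: (@le_trans _ _ 1); first by apply: aexp_le_cst => *.
  rewrite lerDl addr_ge0 ?mulr_ge0 // sumr_ge0 // => j _.
  by rewrite mulr_ge0 // iid0.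
rewrite add0r -[m%:R * c]mul1r -[X in X *
  (m%:R * c)](p_sum1 y) mulr_suml -big_split /=.
apply: ler_sum => j _; rewrite -mulrDr; apply: ler_wpM2l => //.
rewrite lookup_source //; apply: (IH ((a, y) :: E) (y, j)) => //.
by rewrite /= addSn -addnS.
Qed.

Definition loss z : R := \sum_(a <- z) - ln (p a.1 a.2).

Section Chebyshev.
Let h : R := mean (fun y => \sum_j p y j * - ln (p y j)).
Variable V : R.
Hypothesis leV : mean (fun y => \sum_j p y j * ln (p y j) ^+ 2) <= V.

(** The shift [d] carries the centred losses of earlier steps through the induction; cross terms
    vanish on average, and the variance is at most the second moment. *)
Lemma iid_square m d :
  iid m (fun z => (loss z - m%:R * h + d) ^+ 2) <= d ^+ 2 + m%:R * V.
Proof.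
elim: m d => [|m IH] d.
  by rewrite /= /loss big_nil !mul0r subr0 add0r addr0.
have -> : iid m.+1 (fun z => (loss z - m.+1%:R * h + d) ^+ 2) =
    mean (fun y => \sum_j p y j *
      iid m (fun z => (loss z - m%:R * h + (d - ln (p y j) - h)) ^+ 2)).
  rewrite /=; congr (_ * _); apply: eq_bigr => y _; apply: eq_bigr => j _.
  congr (_ * _); congr iid; apply/funext => z.
  by rewrite /loss big_cons /= -natr1; congr (_ ^+ 2); ring.
apply: (@le_trans _ _ (mean (fun y => \sum_j p y j *
    ((d - ln (p y j) - h) ^+ 2 + m%:R * V)))).
  by apply: mean_le => y; apply: ler_sum => j _; apply: ler_wpM2l.
have -> : mean (fun y => \sum_j p y j * ((d - ln (p y j) - h) ^+ 2 + m%:R * V)) =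
   mean (fun y => ((d - h) ^+ 2 + m%:R * V) +
     ((\sum_j p y j * - ln (p y j)) * (2 * (d - h)) +
     \sum_j p y j * ln (p y j) ^+ 2)).
  congr (_ * _); apply: eq_bigr => y _.
  rewrite -[X in _ = X + _]mul1r -[X in _ = X * _ +
    _](p_sum1 y) !mulr_suml -!big_split /=.
  by apply: eq_bigr => j _; ring.
rewrite !mean_add !(mean_const n_gt0) mean_mulr -/h -natr1; move: leV; rewrite /=.
set v := mean _; have := sqr_ge0 h. lra.
Qed.

Lemma iid_deviation m (del : R) (F : seq step -> bool) : 0 < del ->
  (forall z, size z = m -> F z -> del <= `|loss z - m%:R * h|) ->
  iid m (fun z => (F z)%:R) <= m%:R * V / del ^+ 2.
Proof.
move=> del0 Fdel; have del2 : 0 < del ^+ 2 by rewrite exprn_gt0.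
rewrite ler_pdivlMr // mulrC -iidZ.
apply: le_trans (_ : 0 ^+ 2 + m%:R * V <= _); last by rewrite expr0n add0r.
apply: le_trans (iid_square m 0); apply: iid_le => z sz; rewrite addr0.
have [Fz|_] := boolP (F z); last by rewrite mulr0 sqr_ge0.
by rewrite mulr1 -[leRHS]real_normK ?num_real // lerXn2r ?nnegrE ?(ltW del0) ?Fdel.
Qed.

End Chebyshev.

Variables (lam w0 lo hi : R).

Fixpoint light_hit (S : seq 'I_n) (w : R) z y : bool :=
  if z is a :: z' then
    ((a.1 \in S) && (w < lam)) || light_hit S (w * p a.1 a.2) z' y
  else (y \in S) && (w < lam).

Definition atypical (w : R) : bool := (w < lo) || (hi < w).

Definition no_small_step z : bool := all (fun a => w0 <= p a.1 a.2) z.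

(* [w] is the weight already accumulated when the trajectory [z] starts. *)
Definition bad S (w : R) (s : nat) z y : bool :=
  [&& ~~ light_hit S w z y, no_small_step z, w * wt p (take s z) < lam
    & atypical (w * wt p z)].

Lemma aexp_bad0 m E S w s x : x \in S -> w < lam ->
  aexp p m E x (fun z _ y => (bad S w s z y)%:R) = 0.
Proof.
move=> xS wl; case: m => [|m] /=; first by rewrite /bad /= xS wl.
have z0 H : (forall z E' y', H z E' y' = 0) -> forall E' y', aexp p m E' y' H = 0.
  move=> HE E' y'; rewrite -[RHS](aexp_cst p_sum1 m E' y' 0).
  by apply: eq_aexp => // z E'' y'' _ _; rewrite HE.
rewrite big1 // => j _; case: lookup => [y|]; rewrite ?z0 ?mulr0 //.
- by move=> z E' y'; rewrite /bad /= xS wl.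
- rewrite big1 ?mulr0 // => y _; apply: z0 => z E' y'.
  by rewrite /bad /= xS wl.
Qed.

Variables (T m0 : nat) (bet : R).
Hypothesis w0_ge0 : 0 <= w0.
Hypothesis lam_ge0 : 0 <= lam.
Hypothesis bet_ge0 : 0 <= bet.
Hypothesis iid_atypical : forall m w, (m0 <= m < T)%N -> lam * w0 <= w <= 1 ->
  iid m (fun z => (no_small_step z && atypical (w * wt p z))%:R) <= bet.

(** Revealed edges end in [S], and a bad trajectory is never light in [S]. As it becomes light
    within [s] steps, it must take a new edge while its weight is still at least [lam]. From that
    uniform landing point the comparison with independent steps applies, with at least [m0] and
    fewer than [T] steps to go. *)
Lemma aexp_bad E S s w x : (s + m0 <= T)%N -> (size E + (s + m0) <= M)%N ->
  x \in S -> (forall a y, (a, y) \in E -> y \in S) -> 0 <= w <= 1 ->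
  aexp p (s + m0) E x (fun z _ y => (bad S w s z y)%:R) <= T%:R * c + bet.
Proof.
move=> + + + ES; have b0 : 0 <= T%:R * c + bet by rewrite addr_ge0 ?mulr_ge0.
elim: s w x => [|s IH] w x sT EM xS w01.
  have [wl|lw] := ltP w lam; first by rewrite aexp_bad0.
  rewrite -[leRHS](aexp_cst p_sum1 (0 + m0) E x); apply: aexp_le => // z E' y _ _.
  by rewrite /bad take0 wt_nil mulr1 ltNge lw /= !andbF.
have [wl|lw] := ltP w lam; first by rewrite aexp_bad0.
have /andP[w_ge0 w_le1] := w01.
rewrite addSn /= -[leRHS]mul1r -[X in _ <= X * _](p_sum1 x) mulr_suml.
apply: ler_sum => j _; apply: ler_wpM2l => //.
have badE z y : bad S w s.+1 ((x, j) :: z) y =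
    [&& w0 <= p x j & bad S (w * p x j) s z y].
  rewrite /bad /= ltNge lw andbF /= wt_cons !mulrA wt_cons /= !mulrA.
  by case: (w0 <= p x j); rewrite ?andbF.
have wp01 : 0 <= w * p x j <= 1.
  by rewrite mulr_ge0 // mulr_ile1 // p_le1.
have [w0p|w0p] := boolP (w0 <= p x j); last first.
  have z0 E' y : aexp p (s + m0) E' y (fun z _ y' => (bad S w s.+1 ((x,
    j) :: z) y')%:R) <= T%:R * c + bet.
    by apply: aexp_le_cst => // z E'' y' _ _; rewrite badE (negbTE w0p).
  case: lookup => [y|]; first exact: z0.
  by rewrite -[leRHS](mean_const n_gt0); apply: mean_le => y; exact: z0.
case El : lookup => [y|].
  apply: le_trans (IH (w * p x j) y _ _ _ _) => //.
  - by apply: aexp_le => // z E' y' _ _; rewrite badE w0p.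
  - by rewrite ltnW.
  - by rewrite ltnW // -addnS.
  - exact: ES (lookupP El).
apply: le_trans (_ : (s + m0)%:R * c + bet <= _); last first.
  by rewrite lerD2r ler_wpM2r // ler_nat ltnW.
apply: le_trans (le_trans (mean_aexp_iid (x,
  j) _ (_ : (size E + (s + m0) < M.+1)%N)) _); first last.
(* Before the new edge the weight is at least [lam], and the edge itself has weight at least
   [w0]. *)
- rewrite lerD2l; apply: (iid_atypical (w := w * p x j)).
    by rewrite leq_addl.
  by case/andP: wp01 => _ ->; rewrite andbT ler_pM.
- by rewrite ltnS ltnW // -addnS.
- by move=> z /=; rewrite ler0n lern1 leq_b1.
apply: mean_le => y; apply: aexp_le => // z E' y' _ _.
by rewrite badE w0p; apply: ler_bool => /= /and4P[_ -> _ ->].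
Qed.

(** In logarithms, an atypical weight is a deviation of [loss] by [del]. The weight [w] accumulated
    before costs at most [L] on the side of [lo], and on the side of [hi] the sign of [ln w] is
    favourable. *)
Lemma iid_atypical_bound (V L del : R) (h := mean (fun y => \sum_j p y j * - ln
  (p y j)))
    m w (l0 h0 : R) :
  mean (fun y => \sum_j p y j * ln (p y j) ^+ 2) <= V ->
  0 < del -> 0 < w0 -> 0 < w -> - ln w <= L -> w <= 1 ->
  lo = expR (- l0) -> hi = expR (- h0) ->
  m%:R * h + del + L <= l0 -> h0 <= m%:R * h - del ->
  iid m (fun z => (no_small_step z && atypical (w * wt p z))%:R) <=
    m%:R * V / del ^+ 2.
Proof.
move=> leV del0 w00 w_gt0 wL w_le1 loE hiE le_lo le_hi.
apply: (iid_deviation leV del0) => z _ /andP[zp].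
(* Positivity of the steps matters: with [ln 0 = 0], a vanishing step would not show in [loss]. *)
have lossE : 0 < wt p z /\ ln (wt p z) = - loss z.
  elim: z zp => [|a z IH] /=; first by rewrite wt_nil ln1 /loss big_nil oppr0.
  move=> /andP[w0a /IH[wz lz]]; have pa : 0 < p a.1 a.2 := lt_le_trans w00 w0a.
  rewrite wt_cons mulr_gt0 //; split=> //.
  by rewrite lnM ?posrE // lz /loss big_cons opprD opprK.
have [wz lz] := lossE; have wwz : 0 < w * wt p z by rewrite mulr_gt0.
have lw : ln w <= 0 by apply: ln_le0.
rewrite /atypical loE hiE -[w * _]lnK ?posrE // !ltr_expR lnM ?posrE // lz.
rewrite -/h; case/orP => dev.
- have : del <= loss z - m%:R * h by lra.
  by move=> dl; rewrite (le_trans dl) // ler_norm.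
- have : del <= - (loss z - m%:R * h) by lra.
  by move=> dl; rewrite (le_trans dl) // -normrN ler_norm.
Qed.

End Deviation.

(** * Quenched estimates *)

Section Quenched.
Variables (R : realType) (n : nat) (p : 'M[R]_n).
Hypothesis p_ge0 : forall i j, 0 <= p i j.
Hypothesis p_sum1 : forall i, \sum_j p i j = 1.

Local Notation step := ('I_n * 'I_n)%type.
Local Notation edge := ('I_n * 'I_n * 'I_n)%type.
Local Notation env := {ffun 'I_n -> 'S_n}.

Implicit Types (s : env) (E : seq edge) (z : seq step) (x y i : 'I_n) (a b : step).

Lemma qexp_take s l m x (F : seq step -> R) : (l <= m)%N ->
  qexp p s m x (fun z _ => F (take l z)) = qexp p s l x (fun z _ => F z).
Proof.
move=> lm; rewrite -(subnKC lm) qexp_add; apply: eq_qexp => // z y sz _.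
rewrite -[RHS](qexp_cst p_sum1 s (m - l) y); apply: eq_qexp => // z' y' _ _.
by rewrite take_size_cat.
Qed.

(** Union bound over the steps, with Markov's inequality for the squared logarithm at each of
    them. *)
Lemma qexp_small_step s m x (V l : R) :
  (forall y, \sum_j p y j * ln (p y j) ^+ 2 <= V) -> 0 < l ->
  qexp p s m x (fun z _ => (~~ no_small_step p (expR (- l)) z)%:R) <=
    m%:R * V / l ^+ 2.
Proof.
move=> leV l0; have l2 : 0 < l ^+ 2 by rewrite exprn_gt0.
elim: m x => [|m IH] x; first by rewrite /= !mul0r.
have small j : p x j * (~~ (expR (- l) <= p x j))%:R <=
  p x j * ln (p x j) ^+ 2 / l ^+ 2.
  have := p_ge0 x j; rewrite le_eqVlt => /orP[/eqP <-|p0]; first by rewrite !mul0r.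
  rewrite -ltNge; case: ltP => [pl|_]; last first.
    by rewrite mulr0 divr_ge0 ?(ltW l2) // mulr_ge0 ?(ltW p0) ?sqr_ge0.
  rewrite -mulrA ler_wpM2l // ler_pdivlMr // mul1r -[leRHS]sqrrN.
  have lln : l <= - ln (p x j).
    by rewrite lerNr -[- l]expRK ler_ln ?posrE ?expR_gt0 // ltW.
  by rewrite lerXn2r ?nnegrE ?(ltW l0) // (le_trans (ltW l0)).
apply: (@le_trans _ _ (\sum_j (p x j * ln (p x j) ^+ 2 / l ^+ 2 +
  p x j * (m%:R * V / l ^+ 2)))).
  rewrite /=; apply: ler_sum => j _; apply: le_trans (lerD (small j) (lexx _)).
  rewrite -mulrDr ler_wpM2l //; apply: le_trans (lerD (lexx _) (IH (s x j))).
  rewrite -[X in X + _](qexp_cst p_sum1 s m (s x j)) -qexpD;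
    apply: qexp_le => // z y _ _.
  by rewrite /no_small_step /= negb_and -natrD ler_nat; case: (_ <= _);
    case: (all _ _).
rewrite big_split /= -!mulr_suml p_sum1 mul1r -mulrDl ler_wpM2r ?invr_ge0 ?(ltW l2)
  //.
by rewrite -natr1 [leRHS]mulrDl mul1r [leLHS]addrC lerD2l.
Qed.

Lemma qexp_light_hit s m x (lam w : R) (S : seq 'I_n) :
  qexp p s m x (fun z y => (light_hit p lam S w z y)%:R) <=
  \sum_(0 <= l < m.+1) qexp p s l x (fun z y => ((y \in S) && (w * wt p z < lam))%:R).
Proof.
elim: m x w => [|m IH] x w; first by rewrite big_nat1 /= wt_nil mulr1.
rewrite big_nat_recl // [X in X + _]/= wt_nil mulr1.
have -> : \sum_(0 <= l < m.+1) qexp p s l.+1 x (fun z y => ((y \in S) &&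
  (w * wt p z < lam))%:R) =
    \sum_j p x j * \sum_(0 <= l < m.+1) qexp p s l (s x j)
      (fun z y => ((y \in S) && (w * p x j * wt p z < lam))%:R) :> R.
  rewrite /= exchange_big; apply: eq_bigr => j _; rewrite mulr_sumr.
  apply: eq_bigr => l _; congr (_ * _); apply: eq_qexp => // z y _ _.
  by rewrite wt_cons mulrA.
rewrite -[X in X + _]mul1r -[X in X * _ + _](p_sum1 x) mulr_suml.
rewrite -big_split /=; apply: ler_sum => j _.
rewrite -mulrDr ler_wpM2l //.
apply: le_trans (lerD (lexx _) (IH (s x j) (w * p x j))).
rewrite -[X in X + _](qexp_cst p_sum1 s m (s x j)) -qexpD;
  apply: qexp_le => // z y _ _.
by rewrite -natrD ler_nat; case: (_ && _); case: light_hit.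
Qed.

(** The event does not mention endpoints, so one bound serves all [y0] in [light_endpoint]. *)
Definition coalescence s l i : R :=
  qexp p s l i (fun z1 _ => qexp p s l i (fun z2 _ => qexp p s l i (fun z3 _ =>
    (1 < excess i (ext s (ext s (ext s [::] z1) z2) z3))%N%:R))).

(* Three distinct light trajectories with the same length and endpoint create
   two cycles, whereas coincidences among three are unlikely since a light
   trajectory carries little mass. *)
Lemma light_endpoint s l i y0 (lam kap : R) :
  6 * lam <= kap -> 0 < kap ->
  kap < qexp p s l i (fun z y => ((y == y0) && (wt p z < lam))%:R) ->
  kap ^+ 3 <= 2 * coalescence s l i.
Proof.
move=> lam_kap kap0; set Q := qexp _ _ _ _ _ => kapQ.
pose B z y : R := ((y == y0) && (wt p z < lam))%:R.
have B0 z y : 0 <= B z y by rewrite /B ler0n.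
have Qge0 : 0 <= Q by apply: qexp_ge0.
have QE : Q = qexp p s l i B by [].
have lam_ge0 : 0 <= lam.
  rewrite leNgt; apply/negP => lam0; move: kapQ; rewrite QE ltNge => /negP; apply.
  rewrite -[leRHS](qexp_cst p_sum1 s l i); apply: qexp_le => // z y _ _.
  by rewrite /B (le_gtF (le_trans (ltW lam0) (wt_ge0 p_ge0 z))) andbF ltW.
have point z0 (y1 : 'I_n) : wt p z0 < lam ->
  qexp p s l i (fun z y => (z == z0)%:R * B z y) <= lam.
  move=> z0l; apply: le_trans (qexp_point p_ge0 p_sum1 _ _ _ _ _) _ => //.
  apply: le_trans (ltW z0l); rewrite ler_piMr ?wt_ge0 //; case: ifP => // _.
  by rewrite /B lern1 leq_b1.
pose T z1 z2 z3 : R := (1 < excess i (ext s (ext s (ext s [::] z1) z2) z3))%N%:R.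
(* Either the three walks are distinct and create two cycles, or two of them coincide. *)
have bound z1 y1 z2 y2 z3 y3 : size z1 = l -> size z2 = l -> size z3 = l ->
    walk s i z1 y1 -> walk s i z2 y2 -> walk s i z3 y3 ->
    B z1 y1 * (B z2 y2 * B z3 y3) <=
    T z1 z2 z3 + (B z1 y1 * ((z2 == z1)%:R * B z2 y2) * B z3 y3 +
      B z1 y1 * B z2 y2 * ((z3 == z1)%:R * B z3 y3) +
      B z1 y1 * B z2 y2 * ((z3 == z2)%:R * B z3 y3)).
  move=> sz1 sz2 sz3 w1 w2 w3; rewrite /B.
  case: eqP => [e1|_]; last by rewrite !mul0r !addr0 /T ler0n.
  case: eqP => [e2|_]; last by rewrite !(mul0r, mulr0) !addr0 /T ler0n.
  case: eqP => [e3|_]; last by rewrite !(mul0r, mulr0) !addr0 /T ler0n.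
  case: (_ < lam); last by rewrite !mul0r !addr0 /T ler0n.
  case: (_ < lam); last by rewrite !(mul0r, mulr0) !addr0 /T ler0n.
  case: (_ < lam); last by rewrite !(mul0r, mulr0) !addr0 /T ler0n.
  rewrite /= !(mulr1, mul1r) -!natrD ler_nat.
  have [e21|n21] := eqVneq z2 z1; first by rewrite !addn_gt0 orbT.
  have [e31|n31] := eqVneq z3 z1; first by rewrite !addn_gt0 orbT.
  have [e32|n32] := eqVneq z3 z2; first by rewrite !addn_gt0 orbT.
  have uz : uniq [:: z1; z2; z3].
    by rewrite /= !inE negb_or -(eq_sym z2) -(eq_sym z3 z1) -(eq_sym z3 z2) n21 n31
      n32.
  rewrite (@three_walks_excess _ s i z1 z2 z3 y0) //.
  - by rewrite -e1.
  - by rewrite -e2.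
  - by rewrite -e3.
  - by rewrite sz1.
  - by rewrite sz2.
have Q3 : Q ^+ 3 <= coalescence s l i + 3 * (lam * Q ^+ 2).
  have -> : Q ^+ 3 = qexp p s l i (fun z1 y1 => qexp p s l i (fun z2 y2 =>
      qexp p s l i (fun z3 y3 => B z1 y1 * (B z2 y2 * B z3 y3)))).
    transitivity (qexp p s l i (fun z1 y1 => Q ^+ 2 * B z1 y1)).
      by rewrite qexpZ -QE -exprSr.
    apply: eq_qexp => // z1 y1 _ _;
      transitivity (qexp p s l i (fun z2 y2 => B z1 y1 * (Q * B z2 y2))).
      by rewrite !qexpZ -QE; ring.
    by apply: eq_qexp => // z2 y2 _ _; rewrite !qexpZ -QE; ring.
  have pointB z0 y1 : B z0 y1 * qexp p s l i (fun z y => (z == z0)%:R * B z y) <=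
    B z0 y1 * lam.
    rewrite /B; case: (boolP (wt p z0 < lam)) => [z0l|_];
      last by rewrite andbF !mul0r.
    by apply: ler_wpM2l; rewrite ?ler0n //; exact: point.
  have inner z1 y1 z2 y2 : size z1 = l -> walk s i z1 y1 -> size z2 = l ->
    walk s i z2 y2 ->
      qexp p s l i (fun z3 y3 => B z1 y1 * (B z2 y2 * B z3 y3)) <=
      qexp p s l i (fun z3 _ => T z1 z2 z3) +
        (B z1 y1 * Q * ((z2 == z1)%:R * B z2 y2) + 2 * lam * B z1 y1 * B z2 y2).
    move=> sz1 w1 sz2 w2.
    apply: le_trans (qexp_le p_ge0
      (fun z3 y3 sz3 w3 => bound z1 y1 z2 y2 z3 y3 sz1 sz2 sz3 w1 w2 w3)) _.
    rewrite !qexpD !qexpZ -QE.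
    have := ler_wpM2l (B0 z2 y2) (pointB z1 y1).
    have := ler_wpM2l (B0 z1 y1) (pointB z2 y2).
    set q1 := qexp _ _ _ _ _; set q2 := qexp _ _ _ _ _; set q3 := qexp _ _ _ _ _.
    by rewrite !mulrA; lra.
  have middle z1 y1 : size z1 = l -> walk s i z1 y1 ->
      qexp p s l i (fun z2 y2 => qexp p s l i (fun z3 y3 => B z1 y1 *
        (B z2 y2 * B z3 y3))) <=
      qexp p s l i (fun z2 _ => qexp p s l i (fun z3 _ => T z1 z2 z3)) +
        3 * lam * Q * B z1 y1.
    move=> sz1 w1.
    apply: le_trans (qexp_le p_ge0 (fun z2 y2 => inner z1 y1 z2 y2 sz1 w1)) _.
    rewrite !qexpD !qexpZ -QE; have := ler_wpM2l Qge0 (pointB z1 y1).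
    set q1 := qexp _ _ _ _ _; set q2 := qexp _ _ _ _ _; lra.
  apply: le_trans (qexp_le p_ge0 middle) _.
  by rewrite qexpD qexpZ -QE /coalescence lerD2l expr2; lra.
(* As [6 * lam <= kap < Q], the three coincidence terms are absorbed in half of [Q ^+ 3]. *)
have : 3 * (lam * Q ^+ 2) <= Q ^+ 3 / 2.
  have : 0 <= Q ^+ 2 * (Q - 6 * lam).
    by rewrite mulr_ge0 ?sqr_ge0 // subr_ge0 (le_trans lam_kap) // ltW.
  by rewrite !exprS; lra.
have : kap ^+ 3 <= Q ^+ 3 by rewrite lerXn2r ?nnegrE ?(ltW kap0) ?(ltW kapQ).
lra.
Qed.

End Quenched.

(** * Typicality in a fixed environment, by repeated chains *)

Section Assembly.
Variables (R : realType) (n : nat) (p : 'M[R]_n).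
Hypothesis p_ge0 : forall i j, 0 <= p i j.
Hypothesis p_sum1 : forall i, \sum_j p i j = 1.

Local Notation step := ('I_n * 'I_n)%type.
Local Notation edge := ('I_n * 'I_n * 'I_n)%type.
Local Notation env := {ffun 'I_n -> 'S_n}.

Implicit Types (s : env) (E : seq edge) (z : seq step) (x y i : 'I_n) (a b : step).

Variables (lam l lo hi : R) (h t : nat).

Let w0 : R := expR (- l).

(** The probability that [k] successive chains from [i] in the environment [s] are all bad, each
    with respect to the vertices revealed before it. *)
Fixpoint all_bad s i (k : nat) E : R :=
  if k is k'.+1 then
    qexp p s t i (fun z y =>
      (bad p lam w0 lo hi (seen i E) 1 h z y)%:R * all_bad s i k' (ext s E z))
  else 1.

Lemma all_bad_ge0 s i k E : 0 <= all_bad s i k E.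
Proof.
elim: k E => [|k IH] E //=; apply: qexp_ge0 => // z y _ _.
by rewrite mulr_ge0 ?ler0n.
Qed.

Lemma all_bad_ge s i k E (d : R) B : 0 <= d -> (size E + k * t <= B)%N ->
  (forall E, (size E <= B)%N ->
     d <= qexp p s t i (fun z y => (bad p lam w0 lo hi (seen i E) 1 h z y)%:R)) ->
  d ^+ k <= all_bad s i k E.
Proof.
move=> d0 + dE; elim: k E => [|k IH] E EB; first by rewrite expr0.
rewrite exprSr; apply: (@le_trans _ _ (d ^+ k * qexp p s t i (fun z y =>
  (bad p lam w0 lo hi (seen i E) 1 h z y)%:R))).
  by rewrite ler_wpM2l ?exprn_ge0 // dE // (leq_trans _ EB) // leq_addr.
rewrite -qexpZ /=; apply: qexp_le => // z y sz _.
rewrite mulrC ler_wpM2l ?ler0n // IH // (leq_trans _ EB) // mulSn addnA leq_add2r.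
by case/andP: (size_ext s E z) => _; rewrite sz.
Qed.

Lemma mem_sum (S : seq 'I_n) y : (y \in S)%:R <= \sum_(y0 <- S) (y == y0)%:R :> R.
Proof.
elim: S => [|y0 S IH]; first by rewrite big_nil.
rewrite big_cons inE; apply: le_trans (lerD (lexx _) IH).
by rewrite -natrD ler_nat; case: (y == y0); case: (y \in S).
Qed.

(** If atypical weights had probability above [del], removing the rare events would leave a
    probability at least [d] of being bad, whatever set of at most [k * t] edges is already
    revealed; by [all_bad_ge] this contradicts the bound on [all_bad]. *)
Lemma quenched_typical s i (V kap d1 d r del : R) (N K k : nat) :
  (forall y, \sum_j p y j * ln (p y j) ^+ 2 <= V) -> 0 < l ->
  0 <= r <= 1 -> 0 <= d -> h = (K.+2 * N)%N -> (h <= t)%N ->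
  (forall y z, walk s y z y -> (0 < size z <= N)%N -> uniq (map fst z) ->
    wt p z <= r) ->
  qexp p s h i (fun z _ => (1 < excess i (ext s [::] z))%N%:R) <= d1 ->
  qexp p s h i (fun z _ => ((lam <= wt p z) && (N <=
    size (ext s [::] z))%N)%:R) <= d1 ->
  (forall m y0, (m <= t)%N ->
     qexp p s m i (fun z y => ((y == y0) && (wt p z < lam))%:R) <= kap) ->
  all_bad s i k [::] < d ^+ k ->
  d1 + d1 + r ^+ K + t%:R * V / l ^+ 2 + (k * t).+1%:R * t.+1%:R * kap + d <= del ->
  qexp p s t i (fun z _ => (atypical lo hi (wt p z))%:R) <= del.
Proof.
move=> leV l0 /andP[r0 r1] d0 hE ht closed exc heavy light allb le_del.
rewrite leNgt; apply/negP => del_lt; move: allb; rewrite ltNge => /negP; apply.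
apply: (@all_bad_ge s i k [::] d (k * t)) => // E EB.
set Qbad := qexp _ _ _ _ _; set Qat := qexp _ _ _ _ _ in del_lt.
pose Qhit := qexp p s t i (fun z y => (light_hit p lam (seen i E) 1 z y)%:R).
pose Qsmall := qexp p s t i (fun z _ => (~~ no_small_step p w0 z)%:R).
pose Qheavy := qexp p s t i (fun z _ => (lam <= wt p (take h z))%R%:R).
(* An atypical trajectory is bad unless it meets [seen i E] while light, has a small step, or is
   still heavy at time [h]. *)
have split_at : Qat <= Qbad + (Qhit + (Qsmall + Qheavy)).
  rewrite -!qexpD; apply: qexp_le => // z y _ _; rewrite /bad !mul1r -!natrD ler_nat.
  rewrite ltNge; case: light_hit; case: no_small_step;
    case: (lam <= wt p (take h z)) => //=;
  by case: atypical.
have hit_le : Qhit <= (k * t).+1%:R * t.+1%:R * kap.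
  apply: le_trans (qexp_light_hit p_ge0 p_sum1 _ _ _ _ _ _) _.
  have kap0 : 0 <= kap.
    by apply: le_trans (light 0%N i _) => //; apply: qexp_ge0.
  apply: (@le_trans _ _ (\sum_(0 <= m < t.+1) (k * t).+1%:R * kap)); last first.
    by rewrite sumr_const_nat subn0 -[leLHS]mulr_natl mulrCA mulrA.
  rewrite big_nat_cond [leRHS]big_nat_cond; apply: ler_sum => m;
    rewrite andbT => /= mt.
  apply: (@le_trans _ _ (\sum_(y0 <- seen i E) qexp p s m i (fun z y =>
    ((y == y0) && (wt p z < lam))%:R))).
    rewrite -(qexp_sum p_ge0 p_sum1); apply: qexp_le => // z y _ _; rewrite mul1r.
    case: (_ < lam); last by rewrite andbF big1 // => y0 _; rewrite andbF.
    rewrite andbT; apply: le_trans (mem_sum _ _) _.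
    by apply: ler_sum => y0 _; rewrite andbT.
  apply: (@le_trans _ _ (\sum_(y0 <- seen i E) kap));
    first by apply: ler_sum => y0 _; exact: light.
  rewrite big_const_seq count_predT iter_addr addr0 -[leLHS]mulr_natl ler_wpM2r //
    ler_nat.
  by rewrite /= size_map ltnS.
(* A walk that is heavy at time [h] has created two cycles, or has revealed [N] edges, or is
   [short]. *)
have heavy_le : Qheavy <= d1 + d1 + r ^+ K.
  rewrite /Qheavy (qexp_take p_ge0 p_sum1 s i (fun z => (lam <= wt p z)%R%:R) ht).
  have short_le : qexp p s h i (short R s i N [::]) <= r ^+ K.
    rewrite hE; apply: (short_bound p_ge0 p_sum1 r0 r1 closed) => //.
    - by rewrite inE eqxx.
  apply: le_trans (lerD (lerD exc heavy) short_le).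
  rewrite -!qexpD; apply: qexp_le => // z y _ _; rewrite /short -!natrD ler_nat.
  by rewrite [(1 < _)%N]ltnNge [(N <= _)%N]leqNgt; case: (lam <= wt p z);
    case: (_ <= 1)%N; case: (_ < N)%N.
have small_le : Qsmall <= t%:R * V / l ^+ 2 by exact: qexp_small_step.
lra.
Qed.

Lemma qexp_ge_point s x z0 y0 G : walk s x z0 y0 -> (forall z y, 0 <= G z y) ->
  wt p z0 * G z0 y0 <= qexp p s (size z0) x G.
Proof.
elim: z0 x G => [|a z0 IH] x G /=; first by move=> /eqP -> _; rewrite wt_nil mul1r.
move=> /andP[/eqP <- w] G0; rewrite (bigD1 a.2) //= -[leLHS]addr0 lerD //.
  rewrite wt_cons -mulrA ler_wpM2l // -surjective_pairing.
  exact: (IH _ (fun z => G (a :: z))).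
by apply: sumr_ge0 => j _; rewrite mulr_ge0 // qexp_ge0.
Qed.

End Assembly.

(** * Averaging over the environment *)

Section Averaging.
Variables (R : realType) (n : nat) (p : 'M[R]_n).
Hypothesis p_ge0 : forall i j, 0 <= p i j.
Hypothesis p_sum1 : forall i, \sum_j p i j = 1.

Local Notation step := ('I_n * 'I_n)%type.
Local Notation edge := ('I_n * 'I_n * 'I_n)%type.
Local Notation env := {ffun 'I_n -> 'S_n}.

Implicit Types (s : env) (E : seq edge) (z : seq step) (x y i : 'I_n) (a b : step).

Variable M : nat.
Hypothesis Mn : (M < n)%N.

Let n_gt0 : (0 < n)%N. Proof. exact: leq_ltn_trans Mn. Qed.

Let c : R := M.+1%:R / n%:R.
Let C : R := n%:R / (n - M)%:R.

Let C_ge1 : 1 <= C.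
Proof.
by rewrite ler_pdivlMr ?ltr0n ?subn_gt0 // mul1r ler_nat leq_subr.
Qed.

Lemma sum_consistent E (k : R) : \sum_(s : env | consistent s E) k = (cnt E)%:R * k.
Proof. by rewrite sumr_const -[LHS]mulr_natl. Qed.

Lemma anneal_static m E x (H : seq step -> seq edge -> 'I_n -> R) :
  (size E + m <= M)%N -> uniq (dom E) -> (forall z E' y, 0 <= H z E' y) ->
  \sum_(s | consistent s E) qexp p s m x (fun z y => H z (ext s E z) y) <=
  C ^+ m * ((cnt E)%:R * aexp p m E x H).
Proof.
move=> EM uE H0; apply: (qexp_anneal p_ge0 p_sum1 x (G := fun _ => H) EM Mn uE) => //.
by move=> z E' y _ _ _; rewrite sum_consistent.
Qed.

Lemma anneal_excess m E x : (size E + m <= M)%N -> uniq (dom E) ->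
  \sum_(s | consistent s E) qexp p s m x (fun z _ => (1 < excess x
    (ext s E z))%N%:R) <=
  C ^+ m * ((cnt E)%:R * excess_potential R n M m (excess x E)).
Proof.
move=> EM uE; apply: le_trans (anneal_static (H := fun _ E' _ =>
  (1 < excess x E')%N%:R) _ EM uE _) _ => //.
rewrite ler_wpM2l ?exprn_ge0 ?(le_trans ler01 C_ge1) // ler_wpM2l //.
have := aexp_excess p_ge0 p_sum1 n_gt0 x 0 x EM; rewrite addn0.
apply: le_trans; apply: aexp_le => // z E' y _ _.
by case: (excess x E') => [|[|e]] //=; rewrite mul0r ?expr0n.
Qed.

(** The three walks are annealed one after the other, the bound for the later ones serving as
    integrand for the earlier; the step counts in the potential add up. *)
Lemma anneal_coalescence m i : (m + (m + m) <= M)%N ->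
  \sum_(s : env) coalescence p s m i <=
  C ^+ (m + (m + m)) * ((@cnt n [::])%:R * ((m + (m + m))%:R * c) ^+ 2).
Proof.
move=> mM; have C0 : 0 <= C := le_trans ler01 C_ge1.
have pot0 k e : 0 <= excess_potential R n M k e.
  by case: e => [|[|e]] //=.
have step2 E : uniq (dom E) -> (size E + (m + m) <= M)%N ->
    \sum_(s | consistent s E) qexp p s m i (fun z2 _ => qexp p s m i (fun z3 _ =>
      (1 < excess i (ext s (ext s E z2) z3))%N%:R)) <=
    C ^+ m * ((cnt E)%:R * aexp p m E i (fun _ E' _ =>
       C ^+ m * excess_potential R n M m (excess i E'))).
  move=> uE EM; apply: (qexp_anneal p_ge0 p_sum1 i
    (G := fun s _ E' _ => qexp p s m i (fun z3 _ => (1 < excess i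
      (ext s E' z3))%N%:R)) _ Mn uE) => //.
  - by rewrite (leq_trans _ EM) // addnA leq_addr.
  - by move=> z E' y; rewrite mulr_ge0 ?exprn_ge0.
  - move=> z E' y _ uE' sE'; rewrite mulrCA; apply: anneal_excess => //.
    by rewrite (leq_trans _ EM) // addnA leq_add2r.
rewrite (eq_bigl (fun s => consistent s [::])) // /coalescence.
apply: le_trans (qexp_anneal p_ge0 p_sum1 i (M := M) (E := [::])
    (G := fun s _ E' _ => qexp p s m i (fun z2 _ => qexp p s m i (fun z3 _ =>
      (1 < excess i (ext s (ext s E' z2) z3))%N%:R)))
    (H := fun _ E' _ => C ^+ (m + m) * excess_potential R n M (m + m) (excess i E'))
    _ Mn _ _ _) _ => //.
- by rewrite add0n (leq_trans _ mM) // leq_addr.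
- by move=> z E' y; rewrite mulr_ge0 ?exprn_ge0.
- move=> z E' y _ uE' sE'; apply: le_trans (step2 E' uE' _) _.
    by rewrite (leq_trans _ mM) // leq_add2r.
  rewrite mulrCA ler_wpM2l // aexpZ mulrA -exprD ler_wpM2l ?exprn_ge0 //.
  apply: aexp_excess => //; apply: leq_trans mM; rewrite leq_add //.
  by rewrite leq_addr.
rewrite aexpZ [X in _ <= X * _]exprD -[leRHS]mulrA ler_wpM2l ?exprn_ge0 //.
rewrite mulrCA ler_wpM2l ?exprn_ge0 // ler_wpM2l //.
apply: le_trans (aexp_excess p_ge0 p_sum1 n_gt0 i (m + m) i _) _ => //.
by rewrite add0n (leq_trans _ mM) // leq_addr.
Qed.

Lemma anneal_heavy m x (lam q : R) r N : (m <= M)%N -> 0 < lam ->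
  mean (fun y => \sum_j p y j ^+ r.+1) + c <= q ->
  \sum_(s : env) qexp p s m x (fun z _ => ((lam <=
    wt p z) && (N < size (ext s [::] z))%N)%:R) <=
  C ^+ m * ((@cnt n [::])%:R * (q ^+ N / lam ^+ r)).
Proof.
move=> mM lam0 q_ge; have C0 : 0 <= C := le_trans ler01 C_ge1.
have q_ge0 : 0 <= mean (fun y => \sum_j p y j ^+ r.+1) + c.
  rewrite addr_ge0 // ?divr_ge0 // mulr_ge0 ?invr_ge0 ?sumr_ge0 // => y _.
  by rewrite sumr_ge0 // => j _; rewrite exprn_ge0.
rewrite (eq_bigl (fun s => consistent s [::])) //.
apply: le_trans (anneal_static (H := fun z E' _ => ((lam <=
  wt p z) && (N < size E')%N)%:R) _ _ _ _) _ => //.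
rewrite ler_wpM2l ?exprn_ge0 // ler_wpM2l // ler_pdivlMr ?exprn_gt0 // mulrC -aexpZ.
apply: le_trans (_ : (mean (fun y => \sum_j p y j ^+ r.+1) + c) ^+ N <= _);
  last first.
  by rewrite lerXn2r ?nnegrE // (le_trans q_ge0).
apply: le_trans (aexp_heavy p_ge0 p_sum1 n_gt0 r x N mM).
apply: aexp_le => // z E' y _ _; case: (N < size E')%N; last by rewrite andbF !mulr0.
rewrite andbT mulr1; case: (leP lam) => [lw|_].
  by rewrite mulr1 lerXn2r ?nnegrE ?(ltW lam0) ?(wt_ge0 p_ge0).
by rewrite mulr0 exprn_ge0 ?(wt_ge0 p_ge0).
Qed.

(** A walk returns to its starting point with a factor [1 / n], which pays for the sum over the [n]
    starting points. *)
Lemma anneal_closed (D : 'I_n -> 'I_n -> bool) m : (m < M)%N ->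
  \sum_(s : env) \sum_y qexp p s m.+1 y (fresh_in R D [::] y ^~ [::]) <=
  C ^+ m.+1 * ((@cnt n [::])%:R * mean (fun y => \sum_j (D y j)%:R : R) ^+ m.+1).
Proof.
move=> mM; have C0 : 0 <= C := le_trans ler01 C_ge1.
set eta := mean _.
have eta0 : 0 <= eta.
  by rewrite mulr_ge0 ?invr_ge0 ?sumr_ge0 // => y _; rewrite sumr_ge0.
rewrite exchange_big /=.
apply: (@le_trans _ _ (\sum_y C ^+ m.+1 * ((@cnt n [::])%:R *
    ((\sum_j (D y j)%:R) * (eta ^+ m / n%:R))))); last first.
  rewrite -mulr_sumr -mulr_sumr -mulr_suml ler_wpM2l ?exprn_ge0 // ler_wpM2l //.
  by rewrite exprSr /eta /mean; lra.
apply: ler_sum => y0 _.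
rewrite (eq_bigl (fun s => consistent s [::])) //.
apply: le_trans (anneal_static (m := m.+1)
  (H := fresh_in R D [::] y0) _ _ _ _) _ => //.
rewrite ler_wpM2l ?exprn_ge0 // ler_wpM2l // mulr_suml; apply: ler_sum => j _.
have cons_le y E' : aexp p m E' y (fun z => fresh_in R D [::] y0 ((y0, j) :: z)) <=
    (D y0 j)%:R * aexp p m E' y (fresh_in R D [:: y0] y0).
  rewrite -aexpZ; apply: aexp_le => // z E'' y'' _ _.
  rewrite /fresh_in -natrM ler_nat mulnb; apply: leq_bool.
  move=> /and4P[/= /andP[y0z uz] _ /andP[Dy zD] ->]; rewrite Dy uz zD /= andbT.
  by apply/allP => b bz; rewrite inE; apply: contraNneq y0z => <-; exact: map_f.
apply: le_trans (_ : mean (fun y => (D y0 j)%:R * aexp p m [:: ((y0, j),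
  y)] y (fresh_in R D [:: y0] y0)) <= _).
  rewrite -[leRHS]mul1r ler_pM ?p_le1 //.
    by rewrite mulr_ge0 ?invr_ge0 // sumr_ge0 // => y _; exact: aexp_ge0.
  by apply: mean_le => y; exact: cons_le.
rewrite /mean -mulr_sumr mulrCA ler_wpM2l //.
apply: (mean_fresh_in p_ge0 p_sum1 D m (S := [:: y0]) (E := [::]) (a := (y0, j)) y0).
  by rewrite inE.
by [].
Qed.

Section AllBad.
Variables (lam l lo hi : R) (h t : nat) (bet : R).
Hypotheses (lam_ge0 : 0 <= lam) (bet_ge0 : 0 <= bet) (ht : (h <= t)%N).
Hypothesis iid_atypical : forall m w, (t - h <= m < t)%N ->
  lam * expR (- l) <= w <= 1 ->
  iid p m (fun z => (no_small_step p (expR (- l)) z && atypical lo hi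
    (w * wt p z))%:R) <= bet.

(** Once the later chains are bounded uniformly in the revealed edges, the present one is bad with
    annealed probability at most [t * c + bet], by [aexp_bad]. *)
Lemma anneal_all_bad i k E : (size E + k * t <= M)%N -> uniq (dom E) ->
  \sum_(s | consistent s E) all_bad p lam l lo hi h t s i k E <=
  C ^+ (k * t) * ((cnt E)%:R * (t%:R * c + bet) ^+ k).
Proof.
have C0 : 0 <= C := le_trans ler01 C_ge1.
have b0 : 0 <= t%:R * c + bet by rewrite addr_ge0 // mulr_ge0 // divr_ge0.
set b := t%:R * c + bet in b0 *; elim: k E => [|k IH] E EM uE.
  by rewrite /= sum_consistent mul0n !expr0 mul1r.
pose B z y : R := (bad p lam (expR (- l)) lo hi (seen i E) 1 h z y)%:R.
have EM' : (size E + t + k * t <= M)%N by rewrite -addnA -mulSn.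
apply: le_trans (qexp_anneal p_ge0 p_sum1 i (M := M) (E := E)
    (G := fun s z E' y => B z y * all_bad p lam l lo hi h t s i k E')
    (H := fun z E' y => C ^+ (k * t) * b ^+ k * B z y)
    _ Mn uE _ _) _.
- by rewrite (leq_trans _ EM') // leq_addr.
- by move=> z E' y; rewrite !mulr_ge0 ?exprn_ge0 ?ler0n.
- move=> z E' y _ uE' sE'; rewrite -mulr_sumr [leRHS]mulrA [leRHS]mulrC.
  rewrite ler_wpM2l ?ler0n //; apply: le_trans (IH E' _ uE') _.
    by rewrite (leq_trans _ EM') // leq_add2r.
  by rewrite mulrCA.
rewrite mulSn exprD -[leRHS]mulrA ler_wpM2l ?exprn_ge0 // [leRHS]mulrCA ler_wpM2l //.
rewrite aexpZ exprSr [leRHS]mulrA ler_wpM2l ?mulr_ge0 ?exprn_ge0 //.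
have -> : t = (h + (t - h))%N by rewrite subnKC.
have := @aexp_bad R n p p_ge0 p_sum1 M n_gt0 lam (expR (- l)) lo hi t (t - h) bet
  (expR_ge0 _) lam_ge0 bet_ge0 iid_atypical E (seen i E) h 1 i.
rewrite subnKC // => aexp_bad_le; apply: le_trans (aexp_bad_le _ _ _ _ _) _ => //.
- by rewrite (leq_trans _ EM') // leq_addr.
- by rewrite inE eqxx.
- by move=> a y aE; rewrite inE; apply/orP; right; apply/mapP; exists (a, y).
- by rewrite ler01 lexx.
Qed.

End AllBad.

End Averaging.

(** The right-hand side carries [r] because the sum is later divided by it. *)
Lemma geometric_le (R : realFieldType) (x r : R) (N : nat) :
  0 <= x -> x <= 2^-1 -> 2^-1 <= r -> \sum_(m < N) x ^+ m.+1 <= 4 * x * r.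
Proof.
move=> x0 x2 r2; apply: (@le_trans _ _ (2 * x)); last by have := ler_wpM2l x0 r2; lra.
suff : \sum_(m < N) x ^+ m.+1 <= 2 * x - 2 * x * x ^+ N.
  have : 0 <= x * x ^+ N by rewrite mulr_ge0 ?exprn_ge0.
  lra.
elim: N => [|m IH]; first by rewrite big_ord0 expr0 mulr1 subrr.
rewrite big_ord_recr /=; apply: le_trans (lerD IH (lexx _)) _.
have : 0 <= x * x ^+ m * (2^-1 - x) by rewrite !mulr_ge0 ?exprn_ge0 ?subr_ge0.
by rewrite !exprS; lra.
Qed.

(** * Counting atypical environments for fixed [n] *)

Section FiniteBound.
Variables (R : realType) (n : nat) (p : 'M[R]_n).
Hypothesis p_ge0 : forall i j, 0 <= p i j.
Hypothesis p_sum1 : forall i, \sum_j p i j = 1.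

Local Notation env := {ffun 'I_n -> 'S_n}.

Variables (M : nat) (lam l lo hi V bet kap d1 d r q del : R) (h t N K k e : nat).
Let c : R := M.+1%:R / n%:R.
Let C : R := n%:R / (n - M)%:R.

Hypotheses (Mn : (M < n)%N) (C_le2 : C ^+ M <= 2).
Hypotheses (hE : h = (K.+2 * N.+1)%N) (ht : (h <= t)%N).
Hypotheses (kM : (k * t <= M)%N) (tM : (t + (t + t) <= M)%N).
Hypotheses (lam0 : 0 < lam) (l_gt0 : 0 < l) (bet_ge0 : 0 <= bet).
Hypotheses (kap0 : 0 < kap) (lam_kap : 6 * lam <= kap).
Hypotheses (d1_gt0 : 0 < d1) (d0 : 0 < d) (r_ge : 2^-1 <= r) (r_le1 : r <= 1).
Hypothesis leV : forall y, \sum_j p y j * ln (p y j) ^+ 2 <= V.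
Hypothesis le_del :
  d1 + d1 + r ^+ K + t%:R * V / l ^+ 2 + (k * t).+1%:R * t.+1%:R * kap + d <= del.
Hypothesis iid_atypical : forall m w, (t - h <= m < t)%N ->
  lam * expR (- l) <= w <= 1 ->
  iid p m (fun z => (no_small_step p (expR (- l)) z && atypical lo hi
    (w * wt p z))%:R) <= bet.
Let eta : R := mean (fun y => \sum_j ((r < p y j)%R)%:R : R).
Hypothesis eta_le : eta <= 2^-1.
Hypothesis q_ge : mean (fun y => \sum_j p y j ^+ e.+1) + c <= q.

Implicit Types (s : env) (i : 'I_n).

Let deg (x j : 'I_n) := r < p x j.
Let closed s := \sum_(m < N.+1) \sum_y qexp p s m.+1 y
  (fresh_in R deg [::] y ^~ [::]).
Let exc s i := qexp p s h i (fun z _ => (1 < excess i (ext s [::] z))%N%:R : R).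
Let heavy s i := qexp p s h i
  (fun z _ => ((lam <= wt p z) && (N < size (ext s [::] z))%N)%:R : R).
Let allbad s i := all_bad p lam l lo hi h t s i k [::].

Let exc_ge0 s i : 0 <= exc s i.
Proof. by apply: qexp_ge0. Qed.

Let heavy_ge0 s i : 0 <= heavy s i.
Proof. by apply: qexp_ge0. Qed.

Let coal_ge0 s m i : 0 <= coalescence p s m i.
Proof. by do 3!apply: qexp_ge0 => // *. Qed.

Let fresh_ge0 s m y : 0 <= qexp p s m y (fresh_in R deg [::] y ^~ [::]).
Proof. by apply: qexp_ge0. Qed.

Lemma ler_sum1 (I : finType) (F : I -> R) (i : I) :
  (forall j, 0 <= F j) -> F i <= \sum_j F j.
Proof. by move=> F0; rewrite (bigD1 i) //= lerDl sumr_ge0. Qed.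

(** A closed walk of weight above [r] has all its steps above [r], and alone it contributes its
    weight to [closed s]. *)
Let closed_le s y z : closed s < r -> walk s y z y -> (0 < size z <= N.+1)%N ->
  uniq (map fst z) -> wt p z <= r.
Proof.
move=> closed_lt w /andP[z0 zN] uz; rewrite leNgt; apply/negP => wz.
have degz : all (fun a => deg a.1 a.2) z.
  apply/allP => a az; apply: lt_le_trans wz _.
  case/path.splitPr: az => z1 z2; rewrite wt_cat wt_cons mulrCA.
  by rewrite ler_piMr // mulr_ile1 ?wt_ge0 ?wt_le1.
have := lt_trans closed_lt wz; rewrite ltNge => /negP; apply.
have z'N : ((size z).-1 < N.+1)%N by rewrite prednK.
have := @ler_sum1 _ (fun m : 'I_N.+1 => \sum_y qexp p s m.+1 y
  (fresh_in R deg [::] y ^~ [::]))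
  (Ordinal z'N) (fun m => sumr_ge0 _ (fun y _ => fresh_ge0 s m.+1 y)).
apply: le_trans; rewrite (_ : (Ordinal z'N : nat).+1 = size z); last exact: prednK.
apply: le_trans (@ler_sum1 _ (fun y => qexp p s (size z) y
  (fresh_in R deg [::] y ^~ [::])) y _) => //.
have := qexp_ge_point p_ge0 p_sum1 w (G := fresh_in R deg [::] y ^~ [::])
  (fun _ _ => ler0n _ _).
by rewrite /fresh_in uz degz eqxx all_predT /= mulr1.
Qed.

Let fail s := [exists i, del < qexp p s t i (fun z _ => (atypical lo hi
  (wt p z))%:R)].

(** If this sum is below 1, every quantity in it is below the threshold that [quenched_typical]
    needs. Its total over [s] therefore bounds the number of failing environments. *)
Let charge s : R := closed s / r + \sum_i (exc s i / d1 + heavy s i / d1 +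
  \sum_(m < t.+1) 2 * coalescence p s m i / kap ^+ 3 + allbad s i / d ^+ k).

Let fail_charge s : (fail s)%:R <= charge s.
Proof.
have r0 : 0 < r by apply: lt_le_trans r_ge; rewrite invr_gt0.
have kap3 : 0 < kap ^+ 3 by rewrite exprn_gt0.
have dk : 0 < d ^+ k by rewrite exprn_gt0.
have closed0 : 0 <= closed s / r.
  by rewrite divr_ge0 ?(ltW r0) // sumr_ge0 // => m _; apply: sumr_ge0.
have t1 i : 0 <= exc s i / d1 by rewrite divr_ge0 // ltW.
have t2 i : 0 <= heavy s i / d1 by rewrite divr_ge0 // ltW.
have t3' i (m : 'I_t.+1) : 0 <= 2 * coalescence p s m i / kap ^+ 3.
  by rewrite divr_ge0 ?mulr_ge0 // ltW.
have t3 i : 0 <= \sum_(m < t.+1) 2 * coalescence p s m i / kap ^+ 3 by apply: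
  sumr_ge0.
have t4 i : 0 <= allbad s i / d ^+ k by rewrite divr_ge0 ?all_bad_ge0 // ltW.
have [/existsP[i faili]|_] := boolP (fail s); last first.
  by rewrite addr_ge0 // sumr_ge0 // => i _; rewrite !addr_ge0.
rewrite leNgt; apply/negP => charge1; move: faili; rewrite ltNge => /negP; apply.
pose F i := exc s i / d1 + heavy s i / d1 +
  \sum_(m < t.+1) 2 * coalescence p s m i / kap ^+ 3 + allbad s i / d ^+ k.
have F0 j : 0 <= F j by rewrite !addr_ge0.
have := ler_sum1 i F0; rewrite /F => Fi.
have lt1 : closed s / r + (exc s i / d1 + heavy s i / d1 +
    \sum_(m < t.+1) 2 * coalescence p s m i / kap ^+ 3 + allbad s i / d ^+ k) < 1.
  by apply: le_lt_trans charge1; rewrite lerD2l.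
have := t1 i; have := t2 i; have := t3 i; have := t4 i => u4 u3 u2 u1.
have c1 : closed s < r by rewrite -[r]mul1r -ltr_pdivrMr //; lra.
have c2 : exc s i <= d1 by rewrite -[leRHS]mul1r -ler_pdivrMr //; lra.
have c3 : heavy s i <= d1 by rewrite -[leRHS]mul1r -ler_pdivrMr //; lra.
have c4 : allbad s i < d ^+ k by rewrite -[ltRHS]mul1r -ltr_pdivrMr //; lra.
apply: (quenched_typical p_ge0 p_sum1 leV l_gt0 _
  (ltW d0) hE ht _ c2 c3 _ c4 le_del) => //.
- by rewrite (ltW r0).
- by move=> y z; exact: closed_le.
(* A likely light endpoint would make one coalescence term at least 1. *)
- move=> m y0 mt; rewrite leNgt;
  apply/negP => /(light_endpoint p_ge0 p_sum1 lam_kap kap0) le_coal.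
  have mt1 : (m < t.+1)%N by [].
  have := @ler_sum1 _ (fun m : 'I_t.+1 => 2 * coalescence p s m i / kap ^+ 3)
    (Ordinal mt1) (t3' i).
  have : 1 <= 2 * coalescence p s m i / kap ^+ 3 by rewrite ler_pdivlMr // mul1r.
  rewrite /=; lra.
Qed.

Lemma atypical_environments :
  \sum_s (fail s)%:R <= 2 * (#|{: env}|%:R * (4 * eta +
    n%:R * ((h%:R * c) ^+ 2 / d1 + q ^+ N / lam ^+ e / d1 +
      t.+1%:R * (2 * (3 * t%:R * c) ^+ 2 / kap ^+ 3) +
      ((t%:R * c + bet) / d) ^+ k))).
Proof.
have r0 : 0 < r by apply: lt_le_trans r_ge; rewrite invr_gt0.
have kap3 : 0 < kap ^+ 3 by rewrite exprn_gt0.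
have dk : 0 < d ^+ k by rewrite exprn_gt0.
have n_gt0 : (0 < n)%N := leq_ltn_trans (leq0n _) Mn.
have C1 : 1 <= C by rewrite ler_pdivlMr ?ltr0n ?subn_gt0 // mul1r ler_nat leq_subr.
have c0 : 0 <= c by rewrite divr_ge0.
have hM : (h <= M)%N by rewrite (leq_trans ht) // (leq_trans _ tM) // leq_addr.
have NM : (N < M)%N.
  by apply: leq_trans hM; rewrite hE leq_pmull.
have eta0 : 0 <= eta.
  by rewrite mulr_ge0 ?invr_ge0 ?sumr_ge0 // => y _; rewrite sumr_ge0.
set tot : R := #|{: env}|%:R.
have tot0 : 0 <= tot by rewrite ler0n.
have cnt_tot : (@cnt n [::])%:R = tot.
  by rewrite /tot /cnt; congr (_%:R); apply: eq_card.
have C_le m (x : R) : (m <= M)%N -> 0 <= x -> C ^+ m * x <= 2 * x.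
  by move=> mM x0; rewrite ler_wpM2r // (le_trans _ C_le2) // ler_weXn2l.
have b1 : \sum_s closed s / r <= 2 * (tot * (4 * eta)).
  rewrite -mulr_suml ler_pdivrMr // exchange_big /=.
  apply: (@le_trans _ _ (\sum_(m < N.+1) 2 * (tot * eta ^+ m.+1))).
    apply: ler_sum => m _.
    have mM : (m < M)%N by rewrite (leq_trans (ltn_ord m)).
    apply: le_trans (anneal_closed p_ge0 p_sum1 Mn deg mM) _.
    by rewrite cnt_tot; apply: C_le => //; rewrite mulr_ge0 // exprn_ge0.
  rewrite -mulr_sumr -mulr_sumr.
  have := ler_wpM2l tot0 (@geometric_le R eta r N.+1 eta0 eta_le r_ge).
  set S := \sum_(m < _) _; lra.
have b2 i : \sum_s exc s i / d1 <= 2 * (tot * ((h%:R * c) ^+ 2 / d1)).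
  rewrite -mulr_suml mulrA mulrA ler_wpM2r ?invr_ge0 ?(ltW d1_gt0) //.
  rewrite (eq_bigl (fun s => consistent s [::])) //.
  apply: le_trans (anneal_excess p_ge0 p_sum1 Mn i (E := [::]) (m := h) _ _) _ => //.
  by rewrite cnt_tot -mulrA; apply: C_le => //; rewrite mulr_ge0 ?sqr_ge0.
have q0 : 0 <= q.
  apply: le_trans q_ge; rewrite addr_ge0 // mulr_ge0 ?invr_ge0 ?sumr_ge0 // => y _.
  by rewrite sumr_ge0 // => j _; rewrite exprn_ge0.
have b3 i : \sum_s heavy s i / d1 <= 2 * (tot * (q ^+ N / lam ^+ e / d1)).
  rewrite -mulr_suml mulrA mulrA ler_wpM2r ?invr_ge0 ?(ltW d1_gt0) //.
  apply: le_trans (anneal_heavy p_ge0 p_sum1 Mn i N hM lam0 q_ge) _ => //.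
  by rewrite cnt_tot -mulrA; apply: C_le => //;
    rewrite mulr_ge0 // divr_ge0 // exprn_ge0 // ltW.
have b4 i : \sum_s \sum_(m < t.+1) 2 * coalescence p s m i / kap ^+ 3 <=
    2 * (tot * (t.+1%:R * (2 * (3 * t%:R * c) ^+ 2 / kap ^+ 3))).
  rewrite exchange_big /=.
  apply: (@le_trans _ _ (\sum_(m < t.+1) 2 * (tot * (2 *
    (3 * t%:R * c) ^+ 2 / kap ^+ 3)))); last first.
    by rewrite sumr_const card_ord -[leLHS]mulr_natl; lra.
  apply: ler_sum => m _; have mt : (m <= t)%N by rewrite -ltnS.
  have mM : (m + (m + m) <= M)%N by apply: leq_trans tM; rewrite !leq_add.
  have m3 : (m + (m + m))%:R * c <= 3 * t%:R * c.
    by rewrite ler_wpM2r // -natrM ler_nat !mulSn mul0n addn0 !leq_add.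
  have coal_le : \sum_s coalescence p s m i <= 2 * (tot * (3 * t%:R * c) ^+ 2).
    apply: le_trans (anneal_coalescence p_ge0 p_sum1 Mn i mM) _; rewrite cnt_tot.
    apply: le_trans (C_le _ _ mM _) _; first by rewrite mulr_ge0 ?sqr_ge0.
    by rewrite ler_wpM2l // ler_wpM2l // lerXn2r ?nnegrE ?mulr_ge0.
  have ik : 0 <= (kap ^+ 3)^-1 by rewrite invr_ge0 ltW.
  rewrite -mulr_suml -mulr_sumr; have := ler_wpM2r ik coal_le; lra.
have b5 i : \sum_s allbad s i / d ^+ k <= 2 * (tot * ((t%:R * c + bet) / d) ^+ k).
  have bk : 0 <= t%:R * c + bet by rewrite addr_ge0 // mulr_ge0.
  rewrite -mulr_suml expr_div_n mulrA mulrA ler_wpM2r ?invr_ge0 ?(ltW dk) //.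
  rewrite (eq_bigl (fun s => consistent s [::])) //.
  apply: le_trans (anneal_all_bad p_ge0 p_sum1 Mn
    (ltW lam0) bet_ge0 ht iid_atypical i (E := [::]) _ _) _ => //.
  by rewrite cnt_tot -mulrA; apply: C_le => //; rewrite mulr_ge0 ?exprn_ge0.
apply: le_trans (ler_sum _ (fun s _ => fail_charge s)) _.
rewrite big_split /= exchange_big /= [tot * _]mulrDr mulrDr; apply: lerD => //.
have -> : forall x : R, 2 * (tot * (n%:R * x)) = \sum_(i < n) (2 * (tot * x)).
  by move=> x; rewrite sumr_const card_ord -[RHS]mulr_natl; ring.
apply: ler_sum => i _; rewrite !big_split /= !mulrDr.
by rewrite !lerD.
Qed.

End FiniteBound.

(** * Trajectories and environments of the model *)

Section QuenchedLaw.
Variables (R : realType) (n : nat).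

Section PathSum.
Variable P : 'M[R]_n.

(** The recursive form of a sum over trajectories lets vertices be exchanged for ranks one step at a
    time. *)
Fixpoint path_sum (t : nat) (x : 'I_n) (G : R -> R) : R :=
  if t is t'.+1 then \sum_y path_sum t' y (fun w => G (P x y * w)) else G 1.

Lemma path_sumZ t x k G : path_sum t x (fun w => k * G w) = k * path_sum t x G.
Proof.
elim: t x G => //= t IH x G; rewrite mulr_sumr; apply: eq_bigr => y _.
by rewrite (IH y (fun w => G (P x y * w))).
Qed.

Definition step_weight t (x : {ffun 'I_t.+1 -> 'I_n}) : R :=
  \prod_(k < t) P (x (widen_ord (leqnSn t) k)) (x (lift ord0 k)).

Lemma path_sumE t i G :
  \sum_(x : {ffun 'I_t.+1 -> 'I_n} | x ord0 == i) G (step_weight x) = path_sum t i G.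
Proof.
elim: t i G => [|t IH] i G /=.
  rewrite (big_pred1 [ffun=> i]) => [|x].
    by rewrite /step_weight big_ord0.
  apply/eqP/eqP => [xi|->]; last by rewrite ffunE.
  by apply/ffunP => k; rewrite ffunE -xi; congr (x _); apply/val_inj; case: k => -[].
pose f (yg : 'I_n * {ffun 'I_t.+1 -> 'I_n}) : {ffun 'I_t.+2 -> 'I_n} :=
  [ffun k => if unlift ord0 k is Some k' then yg.2 k' else yg.1].
pose g (x : {ffun 'I_t.+2 -> 'I_n}) := (x ord0, [ffun k => x (lift ord0 k)]).
have fK : cancel f g.
  move=> [y u]; rewrite /f /g /= ffunE unlift_none; congr pair.
  by apply/ffunP => k; rewrite !ffunE liftK.
have gK : cancel g f.
  move=> x; apply/ffunP => k; rewrite /f ffunE; case: unliftP => [k'|] -> //=.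
  by rewrite ffunE.
rewrite (reindex f) /=; last by exists g => ? _; [exact: fK|exact: gK].
under eq_bigl => yg do rewrite ffunE unlift_none.
transitivity (\sum_(u : {ffun 'I_t.+1 -> 'I_n}) G (step_weight (f (i, u)))).
  rewrite (eq_bigl (fun yg => (yg.1 == i) && true)) => [|yg]; last by rewrite andbT.
  rewrite -(pair_big (fun y => y == i) xpredT (fun y u => G (step_weight (f (y,
    u))))) /=.
  by rewrite big_pred1_eq.
rewrite (partition_big (fun u : {ffun 'I_t.+1 -> 'I_n} => u ord0) xpredT) //=.
apply: eq_bigr => y _; rewrite -IH; apply: eq_bigr => u /eqP uy; congr G.
rewrite /step_weight big_ord_recl; congr (_ * _).
  rewrite !ffunE liftK /= uy.
  by rewrite (_ : widen_ord _ _ = ord0) ?unlift_none //; apply: val_inj.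
apply: eq_bigr => k _; rewrite !ffunE liftK.
rewrite (_ : widen_ord (leqnSn t.+1) (lift ord0 k) = lift ord0 (widen_ord
  (leqnSn t) k)) ?liftK //.
exact: val_inj.
Qed.

Lemma prod_step_weight t (x : trajectory n t) :
  \prod_(1 <= k < t.+1) P (x (inord k.-1)) (x (inord k)) = step_weight x.
Proof.
rewrite big_add1 /= big_mkord; apply: eq_bigr => k _; congr (P (x _) (x _)).
  by apply: val_inj; rewrite /= inordK // ltnS ltnW.
by apply: val_inj; rewrite /= inordK // ltnS.
Qed.

End PathSum.

Variables (p : 'M[R]_n) (s : 'I_n -> 'S_n).

(** The factor [w] is the probability of the path, which equals its weight; each row is reindexed by
    its permutation. *)
Lemma path_sum_qexp t x (F : R -> R) :
  path_sum (transition p s) t x (fun w => w * F w) =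
  qexp p [ffun i => s i] t x (fun z _ => F (wt p z)).
Proof.
elim: t x F => [|t IH] x F; first by rewrite /= wt_nil mul1r.
rewrite /= (reindex_inj (@perm_inj _ (s x))); apply: eq_bigr => j _.
rewrite ffunE mxE permK.
rewrite (_ : (fun w => _) = (fun w => p x j * (w * F (p x j * w)))); last first.
  by apply/funext => w; rewrite mulrA.
rewrite path_sumZ IH; congr (_ * qexp _ _ _ _ _).
by apply/funext => z; apply/funext => y; rewrite wt_cons.
Qed.

Lemma quenchedE t i (A : pred R) :
  quenched (transition p s) i (fun x : trajectory n t => A (weight
    (transition p s) x)) =
  qexp p [ffun i => s i] t i (fun z _ => (A (wt p z))%:R).
Proof.
rewrite /quenched /weight -(path_sum_qexp t i (fun w => (A w)%:R)) -path_sumE.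
rewrite big_mkcondr /=; apply: eq_bigr => x _; rewrite !prod_step_weight.
by case: (A _); rewrite ?mulr1 ?mulr0.
Qed.

End QuenchedLaw.

(** * The law of the environment as a proportion *)

Section Counting.
Context d (T : measurableType d) (R : realType) (Pr : probability T R) (n : nat).
Variable sigma : 'I_n -> T -> 'S_n.
Hypothesis env_sigma : random_environment Pr sigma.

Local Notation env := {ffun 'I_n -> 'S_n}.

Let realize w : env := [ffun i => sigma i w].

Let atom (s : env) : set T := \bigcap_(i in [set: 'I_n]) (sigma i @^-1` [set s i]).

Let measurable_atom s : measurable (atom s).
Proof.
apply: fin_bigcap_measurable => [|i _]; first exact: finite_finset.
by have [unif _] := env_sigma; have [] := unif i (s i).
Qed.

Let Pr_atom s : Pr (atom s) = ((#|{: env}|%:R)^-1)%:E.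
Proof.
have [unif indep] := env_sigma; rewrite /atom (indep (fun i => [set s i])).
under eq_bigr => i _ do rewrite (unif i (s i)).2.
rewrite card_ffun card_Sn card_ord natrX -exprVn.
rewrite (_ : _ ^+ n = \prod_(i < n) (n`!%:R)^-1);
  last by rewrite prodr_const card_ord.
by elim/big_ind2: _ => // x1 x2 y1 y2 -> ->.
Qed.

(** Independence and uniformity give every realization the same mass, and the event is a finite
    disjoint union of realizations. *)
Lemma environment_counting (B : pred env) :
  Pr [set w | B (realize w)] = ((\sum_s (B s)%:R) / #|{: env}|%:R)%:E.
Proof.
pose r := [seq s <- index_enum _ | B s].
have -> : [set w | B (realize w)] = \bigcup_(s in [set` r]) atom s.
  apply/seteqP; split => w /= => [Bw|[s sr sw]].
    exists (realize w); first by rewrite /= mem_filter Bw mem_index_enum.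
    by move=> i _ /=; rewrite ffunE.
  have /andP[Bs _] : B s && (s \in index_enum _) by rewrite -mem_filter.
  rewrite (_ : realize w = s) //.
  by apply/ffunP => i; rewrite ffunE; exact: sw.
rewrite measure_fin_bigcup //; first last.
- by move=> s s' _ _ [w [sw s'w]]; apply/ffunP => i; rewrite -(sw i I) -(s'w i I).
rewrite -fsbig_seq ?filter_uniq ?index_enum_uniq // big_filter.
rewrite (eq_bigr (fun _ => ((#|{: env}|%:R)^-1)%:E)) => [|s _]; last exact: Pr_atom.
rewrite sumEFin mulr_suml; congr (_%:E).
rewrite big_mkcond; apply: eq_bigr => s _.
by case: (B s); rewrite ?mul1r ?mul0r.
Qed.

End Counting.

Section FixedSize.
Variables (R : realType) (n : nat) (p : 'M[R]_n).
Hypothesis p_ge0 : forall i j, 0 <= p i j.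
Hypothesis p_sum1 : forall i, \sum_j p i j = 1.

Local Notation env := {ffun 'I_n -> 'S_n}.

Lemma entropyE : entropy p = mean (fun y => \sum_j p y j * - ln (p y j)).
Proof.
rewrite /entropy /mean -mulrN -sumrN; congr (_ * _); apply: eq_bigr => y _.
by rewrite -sumrN; apply: eq_bigr => j _; rewrite mulrN.
Qed.

Lemma frac_aboveE c : frac_above p c = mean (fun y => \sum_j ((c < p y j)%R)%:R).
Proof.
rewrite /frac_above /mean; congr (_ * _); apply: eq_bigr => y _.
by rewrite big_mkcond; apply: eq_bigr => j _; case: (c < _).
Qed.

Lemma max_log2_ge y : \sum_j p y j * ln (p y j) ^+ 2 <= max_log2 p.
Proof. by rewrite /max_log2; apply: le_bigmax. Qed.

Lemma max_log2_ge0 : 0 <= max_log2 p.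
Proof.
rewrite /max_log2; elim/big_ind: _ => // [u v u0 v0|y _]; first by rewrite le_max u0.
by apply: sumr_ge0 => j _; rewrite mulr_ge0 ?sqr_ge0.
Qed.

Hypothesis n_gt0 : (0 < n)%N.

(** A row without entry above [1 - e] has entropy at least [e], since [- ln u >= 1 - u >= e] for its
    positive entries [u]; the other rows are counted by [frac_above]. *)
Lemma entropy_ge (e : R) : 0 < e < 1 -> e * (1 - frac_above p (1 - e)) <= entropy p.
Proof.
move=> /andP[e0 e1]; rewrite entropyE frac_aboveE.
rewrite -[X in X - _](mean_const n_gt0) mulrBr ![e * mean _]mulrC -!mean_mulr.
rewrite lerBlDr -mean_add; apply: mean_le => y; rewrite mul1r.
have loss0 j : 0 <= p y j * - ln (p y j).
  by rewrite mulr_ge0 // oppr_ge0 ln_le0 // p_le1.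
have [/existsP[j pj]|/existsPn small] := boolP [exists j, 1 - e < p y j].
  rewrite -[leLHS]add0r lerD ?sumr_ge0 // -[leLHS]mul1r ler_wpM2r ?(ltW e0) //.
  by rewrite (bigD1 j) //= pj lerDl sumr_ge0.
rewrite [X in _ + X * _]big1 ?mul0r ?addr0 => [|j _];
  last by rewrite (negbTE (small j)).
rewrite -[leLHS]mul1r -(p_sum1 y) mulr_suml; apply: ler_sum => j _.
have := p_ge0 y j; rewrite le_eqVlt => /orP[/eqP <-|p0]; first by rewrite !mul0r.
apply: ler_wpM2l => //; have pe : p y j <= 1 - e by rewrite leNgt small.
have : ln (1 + (p y j - 1)) <= p y j - 1 by apply: le_ln1Dx; lra.
rewrite addrCA subrr addr0; lra.
Qed.

(** Entries above [1 - e] are counted by [frac_above]; the others satisfy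
    [u ^+ m.+1 <= u * (1 - e) ^+ m]. *)
Lemma mean_power_le (e : R) m : 0 <= e <= 1 ->
  mean (fun y => \sum_j p y j ^+ m.+1) <= frac_above p (1 - e) + (1 - e) ^+ m.
Proof.
move=> /andP[e0 e1]; rewrite frac_aboveE -[X in _ + X](mean_const n_gt0) -mean_add.
apply: mean_le => y; rewrite -[X in _ + X]mul1r -[X in X * _](p_sum1 y) mulr_suml.
rewrite -big_split /=; apply: ler_sum => j _.
case: (ltP (1 - e)) => pj.
  rewrite exprSr (le_trans (ler_piMl _ _)) ?exprn_ile1 ?p_le1 //.
  rewrite (le_trans (p_le1 p_ge0 p_sum1 y j)) // lerDl mulr_ge0 // exprn_ge0 //.
  by rewrite subr_ge0.
rewrite add0r exprS ler_wpM2l // lerXn2r ?nnegrE // subr_ge0 //.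
Qed.

Lemma event_probability d (T : measurableType d) (Pr : probability T R)
    (sigma : 'I_n -> T -> 'S_n) (t : nat) (lo hi del : R) :
  random_environment Pr sigma -> 0 <= del ->
  Pr [set w | let P := transition p (fun i => sigma i w) in
    del < \big[Num.max/0]_(i < n) quenched P i
      (fun x : trajectory n t => weight P x \notin `[lo, hi])] =
  ((\sum_s [exists i, del < qexp p s t i
      (fun z _ => (atypical lo hi (wt p z))%:R)]%:R) / #|{: env}|%:R)%:E.
Proof.
move=> env_sigma del0; rewrite -(environment_counting env_sigma); congr (Pr _).
have notin_atypical w : (w \notin `[lo, hi]) = atypical lo hi w.
  by rewrite in_itv /= negb_and -!ltNge.
apply/seteqP; split => w /=.
  move=> lt_max; apply/existsP; apply: contraPP lt_max => /forallNP le_del.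
  (* The default value 0 of the maximum is at most [del]. *)
  apply/negP; rewrite -leNgt; apply: bigmax_le => // i _.
  rewrite (quenchedE p (fun i => sigma i w) t i (fun v => v \notin `[lo, hi])).
  rewrite leNgt; apply/negP => lt_del; apply: (le_del i).
  apply: lt_le_trans lt_del _; apply: qexp_le => // z y _ _.
  by rewrite notin_atypical.
move=> /existsP[i lt_del].
pose F i' := quenched (transition p (fun i => sigma i w)) i'
  (fun x : trajectory n t => weight (transition p
    (fun i => sigma i w)) x \notin `[lo, hi]).
apply: lt_le_trans (le_bigmax 0 F i); rewrite /F.
rewrite (quenchedE p (fun i => sigma i w) t i (fun v => v \notin `[lo, hi])).
apply: lt_le_trans lt_del _; apply: qexp_le => // z y _ _.
by rewrite notin_atypical.
Qed.

End FixedSize.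

(** * Choice of the constants *)

Lemma four_terms_le (R : realFieldType) (th m f z1 z2 z3 z4 : R) :
  f <= th / 16 -> m * z1 <= th / 16 -> m * z2 <= th / 16 -> m * z3 <= th / 16 ->
  m * z4 <= th / 16 -> 2 * (4 * f + m * (z1 + z2 + z3 + z4)) <= th.
Proof. rewrite !mulrDr; lra. Qed.

Section ParameterChoice.
Variables (R : realType) (n : nat) (p : 'M[R]_n) (t : nat).
Hypothesis p_ge0 : forall i j, 0 <= p i j.
Hypothesis p_sum1 : forall i, \sum_j p i j = 1.

Variables (eps del th c1 c2 e0 e2 a c v D A : R) (K e : nat).
Let x : R := ln n%:R.
Let X : R := 1 + x.
(** As [N] is close to [a * x], this makes [q ^+ N] of order [n^-6]. *)
Let q : R := expR (- (6 / a)).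

Hypotheses (eps0 : 0 < eps) (del0 : 0 < del) (th0 : 0 < th) (c1_gt0 : 0 < c1).
Hypotheses (e00 : 0 < e0) (e0_le : e0 <= 2^-1) (Kdel : (1 - e0) ^+ K <= del / 8).
Hypotheses (a0 : 0 < a) (a_eps : K.+2%:R * a <=
  c1 * (eps / 2)) (a_c1 : K.+2%:R * a <= c1).
Hypotheses (c0 : 0 < c) (c8 : 8 * c <= 1) (ce : c * e%:R <= 1).
Hypothesis (c_eps : c <= eps * e0 * c1 / 16).
Hypotheses (e20 : 0 < e2) (e2_le : e2 <= 1) (e2q : (1 - e2) ^+ e <= q / 3).
Hypotheses (frac_th : frac_above p (1 - e0) <= th / 16).
Hypotheses (frac_half : frac_above p (1 - e0) <= 2^-1).
Hypotheses (frac_q : frac_above p (1 - e2) <= q / 3).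
Hypotheses (D1 : 1 <= D) (c2D : 4 * c2 + 1 <= D).
Hypotheses (t_ge : c1 * x <= t%:R) (t_le : t%:R <= c2 * x).
Hypotheses (x1 : 1 <= x) (ax : 2 <= a * x).
Hypothesis (V_le : max_log2 p <= v * x).
Hypothesis (v_del : c2 * v <= del / 8 * c ^+ 2).
Hypothesis (v_bet : c2 * v <= del / 4 * expR (- 3) / 2 * (eps * e0 * c1 / 8) ^+ 2).
Hypothesis (AX : A * X ^+ 7 <= expR (c * x)).
Hypotheses (A1 : 2 * D ^+ 2 <= A) (A2 : 3 * D <= A * q).
Hypotheses (A3 : 48 * D ^+ 2 <= A * del) (A4 : 8 * D ^+ 2 <= A * (del * expR (- 3))).
Hypotheses (A5 : 128 * D ^+ 4 <= A * (del * th)) (A6 : 16 * D ^+ 5 <= A * th).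
Hypotheses (A7 : 16 <= A * th) (A8 : 128 * expR (12 / a) <= A * (del * th)).

(* [k] chains of [t] steps are run in the same environment; within [h] steps each
   of them becomes light, i.e. its weight drops below [lam]. *)
Let nR : R := n%:R.
Let y : R := expR (c * x).
Let lam : R := expR (- (c * x)).
Let kap : R := 6 * lam.
Let N : nat := (Num.trunc (a * x)).-1.
Let h : nat := (K.+2 * N.+1)%N.
Let k : nat := (Num.trunc x).+1.
Let M : nat := (k * t + (t + (t + t)))%N.
Let cM : R := M.+1%:R / nR.
Let Del : R := eps * e0 * c1 / 8 * x.
Let V : R := max_log2 p.
Let H : R := entropy p.
Let bet : R := t%:R * V / Del ^+ 2.
Let d1 : R := del / 8.
Let d : R := del / 4.

Let x0 : 0 < x. Proof. exact: lt_le_trans x1. Qed.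

Let nE : nR = expR x.
Proof.
rewrite /x lnK // posrE; have [//|] := ltP 0 (n%:R : R).
by move=> /ln0 n0; move: x0; rewrite /x n0 ltxx.
Qed.

Let n0 : 0 < nR. Proof. by rewrite nE expR_gt0. Qed.

Let n_gt0 : (0 < n)%N. Proof. by rewrite -(ltr0n R). Qed.

Let X1 : 1 <= X. Proof. by rewrite lerDl ltW. Qed.

Let A0 : 0 < A.
Proof. by apply: lt_le_trans A1;
  rewrite mulr_gt0 // exprn_gt0 // (lt_le_trans _ D1). Qed.

Let AXy m : (m <= 7)%N -> A * X ^+ m <= y.
Proof.
by move=> m7; apply: le_trans AX; rewrite ler_wpM2l ?(ltW A0) // ler_weXn2l.
Qed.

Let y4n : y ^+ 4 <= nR.
Proof.
rewrite /y -expRM_natl nE ler_expR mulrA ler_piMl ?(ltW x0) //.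
by have := c8; have := c0; lra.
Qed.

Let A1_ge1 : 1 <= A.
Proof. by apply: le_trans A1; have : 1 <= D ^+ 2 by [rewrite exprn_ege1]; lra. Qed.

Let y1 : 1 <= y.
Proof. by apply: le_trans (AXy (leq0n 7)); rewrite expr0 mulr1. Qed.

Let yn : y <= nR.
Proof. by apply: le_trans y4n; rewrite -[leLHS]expr1 ler_weXn2l. Qed.

Let AXn m : (m <= 7)%N -> A * X ^+ m <= nR.
Proof. by move=> m7; apply: le_trans yn; exact: AXy. Qed.

Let c2_ge0 : 0 <= c2.
Proof.
have : 0 < c2 * x by apply: lt_le_trans t_le; apply: lt_le_trans t_ge;
  rewrite mulr_gt0.
by rewrite pmulr_lgt0 // => /ltW.
Qed.

Let tDX : t%:R <= D * X.
Proof.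
apply: le_trans t_le _; rewrite /X; have := c2D; have := c2_ge0; have := x0; nra.
Qed.

Let tDX1 : t.+1%:R <= D * X.
Proof.
rewrite -natr1 /X; have := c2D; have := c2_ge0; have := x0; have := t_le;
  have := D1; nra.
Qed.

Let k_ge : x <= k%:R.
Proof. by apply: ltW; have /andP[] := trunc_itv (ltW x0). Qed.

Let k_le : k%:R <= X.
Proof.
rewrite /k -natr1 /X addrC lerD2l.
by have /andP[] := trunc_itv (ltW x0).
Qed.

Let M_le : M.+1%:R <= D * X ^+ 2.
Proof.
rewrite -natr1 /M natrD natrM (natrD _ t) (natrD _ t t).
have kt : k%:R * t%:R <= X * (c2 * x) :> R by rewrite ler_pM.
have := t_le; have := kt; have := c2D; have := c2_ge0; have := x0;
  rewrite /X => hx hc hD hk ht.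
have : 0 <= c2 * x by rewrite mulr_ge0 // ltW.
have : 0 <= c2 * x * x by rewrite !mulr_ge0 // ltW.
have : 0 <= (D - (4 * c2 + 1)) * (1 +
  x) ^+ 2 by rewrite mulr_ge0 ?sqr_ge0 // subr_ge0.
rewrite !expr2; have : 0 <= x * x by rewrite mulr_ge0 // ltW.
lra.
Qed.

Let Mn2 : 2 * M%:R ^+ 2 <= nR.
Proof.
apply: le_trans (AXn (isT : 4 <= 7)%N).
have : M%:R ^+ 2 <= (D * X ^+ 2) ^+ 2.
  rewrite lerXn2r ?nnegrE ?ler0n //; last by apply: le_trans M_le; rewrite ler_nat.
  by rewrite mulr_ge0 ?sqr_ge0 // (le_trans ler01).
have X4 : 0 <= X ^+ 4 by rewrite exprn_ge0 // (le_trans ler01).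
have := ler_wpM2r X4 A1; rewrite exprMn -exprM; lra.
Qed.

Let Mn : (M < n)%N.
Proof.
rewrite -(ltr_nat R); have [->|M0] := posnP M; first exact: n0.
have : 1 <= M%:R :> R by rewrite ler1n.
move: Mn2; rewrite -/nR expr2; nra.
Qed.

(** Bernoulli's inequality: [(1 - M / n)^M >= 1 - M^2 / n], at least one half because [M] is
    polylogarithmic. *)
Let C_le2 : (n%:R / (n - M)%:R) ^+ M <= 2 :> R.
Proof.
have nM0 : 0 < (n - M)%:R :> R by rewrite ltr0n subn_gt0.
rewrite -[leLHS]invrK -exprVn invf_div -[leRHS]invrK lef_pV2 ?posrE ?invr_gt0
  ?exprn_gt0 ?divr_gt0 //.
have -> : (n - M)%:R / n%:R = 1 - M%:R / nR by rewrite natrB ?(ltnW Mn) // mulrBl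
  divff ?gt_eqF.
have u0 : 0 <= M%:R / nR by rewrite divr_ge0 // ltW.
have u1 : M%:R / nR <= 1 by rewrite ler_pdivrMr // mul1r ler_nat ltnW.
have bern m : 1 - m%:R * (M%:R / nR) <= (1 - M%:R / nR) ^+ m.
  elim: m => [|m IH]; first by rewrite mul0r subr0 expr0.
  have u1' : 0 <= 1 - M%:R / nR by rewrite subr_ge0.
  have := ler_wpM2l u1' IH; rewrite exprS -natr1.
  have : 0 <= m%:R * (M%:R / nR) ^+ 2 by rewrite mulr_ge0 ?sqr_ge0.
  rewrite expr2; lra.
apply: le_trans (bern M); have : M%:R * (M%:R / nR) <= 2^-1.
  by rewrite mulrA ler_pdivrMr // -expr2; have := Mn2; lra.
lra.
Qed.

Let N1_le : N.+1%:R <= a * x.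
Proof.
have ax0 : 0 <= a * x by rewrite mulr_ge0 // ltW.
have /andP[tr_le tr_gt] := trunc_itv ax0.
by rewrite prednK // -(ltr_nat R); have := ax; move: tr_gt; rewrite -natr1; lra.
Qed.

Let N_ge : a * x - 2 <= N%:R.
Proof.
have ax0 : 0 <= a * x by rewrite mulr_ge0 // ltW.
have /andP[tr_le tr_gt] := trunc_itv ax0.
have tr0 : (0 < Num.trunc (a * x))%N.
  by rewrite -(ltr_nat R); have := ax; move: tr_gt; rewrite -natr1; lra.
by move: tr_gt; rewrite -(prednK tr0) -/N -!natr1; lra.
Qed.

Let h_le : h%:R <= K.+2%:R * a * x.
Proof. by rewrite natrM -mulrA ler_wpM2l. Qed.

Let ht : (h <= t)%N.
Proof.
rewrite -(ler_nat R) (le_trans h_le) // (le_trans _ t_ge) //.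
by rewrite ler_wpM2r // ltW.
Qed.

Let h_eps : h%:R <= eps / 2 * t%:R.
Proof.
apply: le_trans h_le _; apply: (@le_trans _ _ (eps / 2 * (c1 * x))).
  by rewrite mulrA [_ * c1]mulrC ler_wpM2r // ltW.
by rewrite ler_wpM2l // divr_ge0 // ltW.
Qed.

Let V0 : 0 <= V. Proof. exact: max_log2_ge0. Qed.

Let tV : t%:R * V <= c2 * v * x ^+ 2.
Proof.
have -> : c2 * v * x ^+ 2 = (c2 * x) * (v * x) by rewrite expr2; ring.
by rewrite ler_pM.
Qed.

Let Del0 : 0 < Del. Proof. by rewrite !mulr_gt0 ?invr_gt0. Qed.

Let x2 : 0 < x ^+ 2. Proof. exact: exprn_gt0. Qed.

Let tVl : t%:R * V / (c * x) ^+ 2 <= del / 8.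
Proof.
rewrite ler_pdivrMr ?exprn_gt0 ?mulr_gt0 //; apply: le_trans tV _.
rewrite exprMn [leRHS]mulrA. by rewrite ler_wpM2r // ltW.
Qed.

Let bet_le : bet <= d * expR (- 3) / 2.
Proof.
rewrite /bet ler_pdivrMr ?exprn_gt0 //; apply: le_trans tV _.
by rewrite /Del exprMn [leRHS]mulrA ler_wpM2r ?(ltW x2).
Qed.

Let bet0 : 0 <= bet.
Proof. by rewrite divr_ge0 ?mulr_ge0 // ltW // exprn_gt0. Qed.

Let cM0 : 0 <= cM. Proof. by rewrite divr_ge0 // ltW. Qed.

Let cM_le : cM <= D * X ^+ 2 / nR.
Proof. by rewrite ler_wpM2r // invr_ge0 ltW. Qed.

Let tcM : t%:R * cM <= D ^+ 2 * X ^+ 3 / nR.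
Proof.
apply: le_trans (ler_pM _ _ tDX cM_le) _ => //.
by rewrite !mulrA ler_wpM2r ?invr_ge0 ?(ltW n0) // !exprS; lra.
Qed.

Let AN0 : 0 < A^-1. Proof. by rewrite invr_gt0. Qed.

Let Xn m : (m <= 7)%N -> X ^+ m / nR <= A^-1.
Proof.
by move=> m7; rewrite ler_pdivrMr // mulrC ler_pdivlMr // mulrC AXn.
Qed.

Let nA : nR^-1 <= A^-1.
Proof. by have := Xn (leq0n 7); rewrite expr0 mul1r. Qed.

Let u : R := D ^+ 2 * X ^+ 3 / nR.

Let u0 : 0 <= u.
Proof. by rewrite divr_ge0 ?(ltW n0) // mulr_ge0 ?sqr_ge0 // exprn_ge0 //
  (le_trans ler01). Qed.

Let d1_gt0 : 0 < d1. Proof. by rewrite divr_gt0. Qed.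

Let d0 : 0 < d. Proof. by rewrite divr_gt0. Qed.

Let excess_term : nR * ((h%:R * cM) ^+ 2 / d1) <= th / 16.
Proof.
have hcM : (h%:R * cM) ^+ 2 <= u ^+ 2.
  rewrite lerXn2r ?nnegrE ?u0 ?(mulr_ge0 (ler0n _ _) cM0) //; apply: le_trans tcM.
  by rewrite ler_wpM2r // ler_nat.
rewrite mulrA ler_pdivrMr //.
apply: (@le_trans _ _ (nR * u ^+ 2)); first by rewrite ler_wpM2l ?(ltW n0).
have -> : nR * u ^+ 2 = D ^+ 4 * (X ^+ 6 / nR).
  by rewrite /u; field; rewrite gt_eqF.
have D4 : 0 <= D ^+ 4 by rewrite exprn_ge0 // (le_trans ler01).
apply: le_trans (ler_wpM2l D4 (Xn (isT : 6 <= 7)%N)) _.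
by rewrite ler_pdivrMr // /d1; have := A5; lra.
Qed.

(** [q ^+ N] is of order [n^-6], and [lam ^+ e >= 1 / n] because [c * e <= 1]. *)
Let heavy_term : nR * (q ^+ N / lam ^+ e / d1) <= th / 16.
Proof.
have x5 : x + - (5 * x) <= - x by have := x0; lra.
have A_th : expR (12 / a) / A <= th / 16 * d1.
  by rewrite ler_pdivrMr // /d1; have := A8; lra.
have qN : q ^+ N <= expR (12 / a - 6 * x).
  rewrite /q -expRM_natl ler_expR mulrN lerNl opprB.
  apply: (@le_trans _ _ ((a * x - 2) * (6 / a))); last first.
    by rewrite ler_wpM2r // divr_ge0 // ltW.
  by rewrite [leRHS](_ : _ = 6 * x - 12 / a) //; field; rewrite gt_eqF.
have le1 : (lam ^+ e)^-1 <= expR x.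
  rewrite /lam -expRM_natl -expRN ler_expR mulrN opprK mulrA mulrC [e%:R * _]mulrC.
  by rewrite ler_piMr // ltW.
have lam_e0 : 0 <= (lam ^+ e)^-1 by rewrite invr_ge0 exprn_ge0 // expR_ge0.
have qN0 : 0 <= q ^+ N by rewrite exprn_ge0 // expR_ge0.
have key : q ^+ N / lam ^+ e <= expR (12 / a) * expR (- (5 * x)).
  apply: le_trans (ler_pM qN0 lam_e0 qN le1) _.
  by rewrite -expRD -expRD ler_expR (_ : 12 / a - 6 * x + x = 12 / a - 5 * x) //;
    ring.
rewrite mulrA ler_pdivrMr //.
apply: (@le_trans _ _ (nR * (expR (12 / a) * expR (- (5 * x))))).
  by rewrite ler_wpM2l ?(ltW n0).
apply: (@le_trans _ _ (expR (12 / a) * nR^-1)).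
  by rewrite mulrCA ler_wpM2l ?expR_ge0 // nE -expRN -expRD ler_expR.
apply: (@le_trans _ _ (expR (12 / a) * A^-1)); first by rewrite ler_wpM2l ?expR_ge0.
exact: A_th.
Qed.

Let y0 : 0 < y. Proof. exact: expR_gt0. Qed.

Let lamE : lam = y^-1. Proof. by rewrite /lam expRN. Qed.

Let kap0 : 0 < kap. Proof. by rewrite mulr_gt0 // expR_gt0. Qed.

(** With [y = n^c], the cube of [kap] costs [y^3], and [y^4 <= n] leaves a factor [1 / y] against
    the polylogarithm. *)
Let coalescence_term :
  nR * (t.+1%:R * (2 * (3 * t%:R * cM) ^+ 2 / kap ^+ 3)) <= th / 16.
Proof.
have tc : (3 * t%:R * cM) ^+ 2 <= (3 * u) ^+ 2.
  have a3 : 0 <= 3 * t%:R * cM by exact: (mulr_ge0 (mulr_ge0 (ler0n _ 3)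
    (ler0n _ t)) cM0).
  have b3 : 0 <= 3 * u by exact: (mulr_ge0 (ler0n _ 3) u0).
  by rewrite lerXn2r ?nnegrE // -mulrA ler_wpM2l.
have Ik : (kap ^+ 3)^-1 = y ^+ 3 / 216.
  by rewrite /kap lamE; field; rewrite gt_eqF.
have y3 : y ^+ 3 / nR <= y^-1.
  by rewrite ler_pdivrMr // mulrC ler_pdivlMr // -exprSr.
have D0 : 0 <= D by apply: le_trans D1.
have X0 : 0 <= X by apply: le_trans X1.
have y30 : 0 <= y ^+ 3 / 216 by apply: divr_ge0 => //; apply: exprn_ge0; exact: ltW.
have t18 : 0 <= 2 * (3 * t%:R * cM) ^+ 2 / kap ^+ 3.
  by rewrite Ik; apply: mulr_ge0 => //; apply: mulr_ge0 => //; exact: sqr_ge0.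
apply: (@le_trans _ _ (nR * ((D * X) * (2 * (3 * u) ^+ 2 / kap ^+ 3)))).
  rewrite ler_wpM2l ?(ltW n0) //; apply: ler_pM => //.
  by rewrite Ik; apply: ler_wpM2r => //; apply: ler_wpM2l.
have -> : nR * (D * X * (2 * (3 * u) ^+ 2 / kap ^+ 3)) = D ^+ 5 / 12 * (X ^+ 7 *
  (y ^+ 3 / nR)).
  by rewrite Ik /u; field; rewrite gt_eqF.
apply: (@le_trans _ _ (D ^+ 5 / 12 * A^-1)).
  rewrite ler_wpM2l ?divr_ge0 ?exprn_ge0 //.
  apply: (@le_trans _ _ (X ^+ 7 * y^-1)); first by rewrite ler_wpM2l // exprn_ge0.
  by rewrite ler_pdivrMr // mulrC ler_pdivlMr // mulrC AXy.
rewrite ler_pdivrMr //; have : 0 <= D ^+ 5 by rewrite exprn_ge0.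
by have := A6; lra.
Qed.

(** Each chain contributes at most [expR (- 3)] and [k >= ln n], which beats the union bound over
    [i]. *)
Let all_bad_term : nR * ((t%:R * cM + bet) / d) ^+ k <= th / 16.
Proof.
have x3 : x + - (3 * x) <= - x by have := x0; lra.
have A_th : A^-1 <= th / 16.
  by rewrite -[leLHS]mul1r ler_pdivrMr //; have := A7; lra.
have k3 : k%:R * - 3 <= - (3 * x) by have := k_ge; lra.
have b0 : 0 <= t%:R * cM + bet by rewrite addr_ge0 // mulr_ge0.
have bd : (t%:R * cM + bet) / d <= expR (- 3).
  rewrite ler_pdivrMr //; have := bet_le; have := tcM.
  have D2 : 0 <= D ^+ 2 by rewrite sqr_ge0.
  have := ler_wpM2l D2 (Xn (isT : 3 <= 7)%N); rewrite mulrA.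
  have : D ^+ 2 * A^-1 <= del * expR (- 3) / 8.
    by rewrite ler_pdivrMr //; have := A4; lra.
  rewrite /d; lra.
have bk : ((t%:R * cM + bet) / d) ^+ k <= expR (- (3 * x)).
  apply: (@le_trans _ _ (expR (- 3) ^+ k)).
    by rewrite lerXn2r ?nnegrE ?expR_ge0 // divr_ge0 // ltW.
  by rewrite -expRM_natl ler_expR.
apply: (@le_trans _ _ (nR * expR (- (3 * x)))); first by rewrite ler_wpM2l ?(ltW n0).
apply: (@le_trans _ _ nR^-1).
  by rewrite nE -expRN -expRD ler_expR.
exact: le_trans nA A_th.
Qed.

Let H_ge : e0 / 2 <= H.
Proof.
have e01 : 0 < e0 < 1 by rewrite e00 /=; have := e0_le; lra.
apply: le_trans (entropy_ge p_ge0 p_sum1 n_gt0 e01).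
by rewrite ler_wpM2l ?(ltW e00) //; have := frac_half; lra.
Qed.

Let H0 : 0 <= H.
Proof. by apply: le_trans H_ge; rewrite divr_ge0 // ltW. Qed.

(** Non-degeneracy bounds the entropy from below, so the window [eps * H * t] exceeds a multiple of
    [ln n]. *)
Let eHt : 4 * Del <= eps * H * t%:R.
Proof.
apply: (@le_trans _ _ (eps * (e0 / 2) * (c1 * x))); first by rewrite /Del; lra.
apply: ler_pM => //; first by rewrite !mulr_ge0 ?(ltW eps0) ?(ltW e00).
  by rewrite mulr_ge0 // ltW.
by rewrite ler_wpM2l // ltW.
Qed.

Let lo : R := expR (- ((1 + eps) * H * t%:R)).
Let hi : R := expR (- ((1 - eps) * H * t%:R)).

(** The window absorbs three errors: at most [h <= eps / 2 * t] missing steps, an initial loss of at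
    most [2 * (c * x) <= Del], and the deviation [Del]. *)
Let iid_atypical m w : (t - h <= m < t)%N -> lam * expR (- (c * x)) <= w <= 1 ->
  iid p m (fun z => (no_small_step p (expR (- (c * x))) z && atypical lo hi
    (w * wt p z))%:R)
    <= bet.
Proof.
move=> /andP[m_ge m_lt] /andP[w_ge w_le1].
have mt : m%:R <= t%:R :> R by rewrite ler_nat ltnW.
have mth : t%:R - h%:R <= m%:R :> R by rewrite lerBlDr -natrD ler_nat addnC
  -leq_subLR.
have w_gt0 : 0 < w by apply: lt_le_trans w_ge; rewrite mulr_gt0 ?expR_gt0.
have lw : - ln w <= 2 * (c * x).
  rewrite lerNl -[leLHS]expRK ler_ln ?posrE ?expR_gt0 //; apply: le_trans w_ge.
  by rewrite -expRD ler_expR; lra.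
have Hm1 : m%:R * H <= t%:R * H by rewrite ler_wpM2r.
have Hm2 : (t%:R - h%:R) * H <= m%:R * H by rewrite ler_wpM2r.
have Hh : h%:R * H <= eps / 2 * t%:R * H by rewrite ler_wpM2r.
have cx : 2 * (c * x) <= Del.
  have := ler_wpM2r (ltW x0) c_eps; rewrite /Del; lra.
apply: le_trans (iid_atypical_bound p_ge0 p_sum1 n_gt0 (V := V) (L := 2 * (c * x))
  (del := Del)
  (l0 := (1 + eps) * H * t%:R) (h0 := (1 - eps) * H * t%:R) _ Del0
    (expR_gt0 _) w_gt0 lw w_le1
  (erefl _) (erefl _) _ _) _.
- rewrite -[leRHS](mean_const n_gt0); apply: mean_le => z; exact: max_log2_ge.
- by rewrite -entropyE -/H; have := eHt; have := Del0; lra.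
- by rewrite -entropyE -/H; have := eHt; have := Del0; lra.
- by rewrite ler_wpM2r ?invr_ge0 ?exprn_ge0 ?(ltW Del0) // ler_wpM2r.
Qed.

Lemma atypical_fraction :
  (\sum_(s : {ffun 'I_n -> 'S_n}) [exists i, del < qexp p s t i
      (fun z _ => (atypical lo hi (wt p z))%:R)]%:R) / #|{: {ffun 'I_n ->
        'S_n}}|%:R <= th.
Proof.
have tot0 : 0 < #|{: {ffun 'I_n -> 'S_n}}|%:R :> R.
  by rewrite ltr0n; apply/card_gt0P; exists [ffun=> 1%g].
rewrite ler_pdivrMr //.
have kt : (k * t <= M)%N by rewrite leq_addr.
have tM : (t + (t + t) <= M)%N by rewrite leq_addl.
have r_ge : 2^-1 <= 1 - e0 by have := e0_le; lra.
have r_le1 : 1 - e0 <= 1 by have := e00; lra.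
(* Five terms of at most [del / 8] and one equal to [del / 4]. *)
have le_del : d1 + d1 + (1 - e0) ^+ K + t%:R * V / (c * x) ^+ 2 +
    (k * t).+1%:R * t.+1%:R * kap + d <= del.
  have hitE : (k * t).+1%:R * t.+1%:R * kap <= del / 8.
    have D0 : 0 <= D by apply: le_trans D1.
    have X0 : 0 <= X by apply: le_trans X1.
    apply: (@le_trans _ _ (D * X ^+ 2 * (D * X) * kap)).
      rewrite ler_wpM2r ?(ltW kap0) //; apply: ler_pM => //.
      by apply: le_trans M_le; rewrite ler_nat ltnS.
    have -> : D * X ^+ 2 * (D * X) * kap = 6 * D ^+ 2 * (X ^+ 3 * y^-1).
      by rewrite /kap lamE; ring.
    apply: (@le_trans _ _ (6 * D ^+ 2 * A^-1)).
      rewrite ler_wpM2l ?mulr_ge0 ?sqr_ge0 //.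
      by rewrite ler_pdivrMr // mulrC ler_pdivlMr // mulrC AXy.
    by rewrite ler_pdivrMr //; have := A3; lra.
  have sum_le (z1 z2 z3 : R) : z1 <= del / 8 -> z2 <= del / 8 -> z3 <= del / 8 ->
      del / 8 + del / 8 + z1 + z2 + z3 + del / 4 <= del by have := del0; lra.
  exact: (sum_le _ _ _ Kdel tVl hitE).
have q_ge : mean (fun y => \sum_j p y j ^+ e.+1) + cM <= q.
  have e2_01 : 0 <= e2 <= 1 by rewrite (ltW e20).
  have := mean_power_le p_ge0 p_sum1 n_gt0 e e2_01.
  have cMq : cM <= q / 3.
    apply: le_trans cM_le _; rewrite -mulrA.
    have D0 : 0 <= D by apply: le_trans D1.
    apply: le_trans (ler_wpM2l D0 (Xn (isT : 2 <= 7)%N)) _.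
    by rewrite ler_pdivrMr //; have := A2; lra.
  by have := frac_q; have := e2q; lra.
have cx0 : 0 < c * x by rewrite mulr_gt0.
have eta_le : mean (fun y : 'I_n => \sum_j ((1 - e0 < p y j)%R)%:R : R) <= 2^-1.
  by rewrite -frac_aboveE.
apply: le_trans (atypical_environments p_ge0 p_sum1 (lam := lam) Mn C_le2
  (erefl _) ht kt tM
  (expR_gt0 _) cx0 bet0 kap0 (lexx _) d1_gt0 d0 r_ge r_le1 (@max_log2_ge _ _ p)
  le_del iid_atypical eta_le q_ge) _.
rewrite -frac_aboveE -/cM -/nR mulrCA mulrC ler_wpM2r ?(ltW tot0) //.
exact: four_terms_le frac_th excess_term heavy_term coalescence_term all_bad_term.
Qed.

End ParameterChoice.

(** * Asymptotics *)

Section Eventually.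
Variable R : realType.

Lemma ler_sum_mem (I : eqType) (r : seq I) (F : I -> R) b :
  b \in r -> {in r, forall b', 0 <= F b'} -> F b <= \sum_(b' <- r) F b'.
Proof.
move=> br F0; rewrite (big_rem b br) /= lerDl big_seq.
by apply: sumr_ge0 => b' /mem_rem/F0.
Qed.

Lemma ln_infty (A : R) : \forall n \near \oo, A <= ln n%:R :> R.
Proof.
near=> n; have An : expR A <= n%:R by near: n; exact: nbhs_infty_ger.
by rewrite -[leLHS]expRK ler_ln ?posrE ?expR_gt0 // (lt_le_trans (expR_gt0 A)).
Unshelve. all: by end_near. Qed.

(** From [expR (b * x) >= 1 + b * x >= b * (1 + x)], the eighth power leaves a spare factor [1 + x],
    eventually above [A / b ^+ 8]. *)
Lemma expR_poly (A c : R) : 0 < c ->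
  \forall n \near \oo, A * (1 + ln n%:R) ^+ 7 <= expR (c * ln n%:R) :> R.
Proof.
move=> c0; pose b : R := Num.min 1 (c / 8).
have b0 : 0 < b by rewrite lt_min ltr01 divr_gt0.
have b1 : b <= 1 by rewrite ge_min lexx.
have b8 : 8 * b <= c by rewrite -ler_pdivlMl // mulrC ge_min lexx orbT.
near=> n.
have x0 : 0 <= ln n%:R :> R by near: n; exact: ln_infty.
have Ax : A / b ^+ 8 <= ln n%:R :> R by near: n; exact: ln_infty.
set x := ln _ in x0 Ax *.
have X0 : 0 <= (1 + x) ^+ 7 by rewrite exprn_ge0 // addr_ge0.
have bx : b * (1 + x) <= expR (b * x).
  by apply: le_trans (expR_ge1Dx _); rewrite mulrDr mulr1 lerD2r.
apply: (@le_trans _ _ (expR (b * x) ^+ 8)); last first.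
  by rewrite -expRM_natl ler_expR mulrA ler_wpM2r.
apply: (@le_trans _ _ ((b * (1 + x)) ^+ 8)); last first.
  by rewrite lerXn2r ?nnegrE ?expR_ge0 // mulr_ge0 ?addr_ge0 // ltW.
rewrite exprMn [X in _ <= _ * X]exprS [leRHS]mulrA ler_wpM2r //.
rewrite mulrC -ler_pdivrMr ?exprn_gt0 // (le_trans Ax) // lerDr.
Unshelve. all: by end_near. Qed.

Lemma small_power (r z : R) : 0 <= r < 1 -> 0 < z -> exists m, r ^+ m <= z.
Proof.
move=> /andP[r0 r1] z0.
have : (fun m => r ^+ m) @ \oo --> (0 : R).
  by apply: cvg_expr; rewrite ger0_norm.
move=> /cvgr0Pnorm_le /(_ z z0) [m _ /(_ m (leqnn m)) /=].
by rewrite ger0_norm ?exprn_ge0 // => rm; exists m.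
Qed.

Lemma frac_above_small (p : forall n, 'M[R]_n) (eta : R) :
  nondegenerate_rows p -> 0 < eta ->
  exists e, [/\ 0 < e, e <= 2^-1 & \forall n \near \oo,
    frac_above (p n) (1 - e) <= eta].
Proof.
move=> nondeg eta0.
have lt_eta : nbhs (0 : \bar R)%E [set y | (y < eta%:E)%E].
  by apply: open_nbhs_nbhs; split; [exact: open_ereal_lt_ereal|rewrite /= lte_fin].
have small : \forall e \near 0^'+, (0 < e) && (e <= 2^-1 :> R).
  near=> e; apply/andP; split; first by near: e; exact: nbhs_right_gt.
  by near: e; apply: nbhs_right_le; rewrite invr_gt0.
have esup_small : \forall e \near 0^'+,
    (limn_esup (fun n => (frac_above (p n)
      (1 - e))%:E) < eta%:E)%E by exact: nondeg lt_eta.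
have [e [esup_lt /andP[e0 e2]]] := filter_ex (filterI esup_small small).
exists e; split=> //.
(* The upper limit is an infimum of suprema over neighbourhoods of infinity; one of these suprema is
   already below [eta]. *)
have [_ [V oV <-] supV] := ereal_inf_lt esup_lt.
apply: filterS oV => n Vn; rewrite -lee_fin; apply: le_trans (ltW supV).
by apply: ereal_sup_ubound; exists n.
Unshelve. all: by end_near. Qed.

End Eventually.

Theorem theorem4 (R : realType) (p : forall n : nat, 'M[R]_n)
    (d : nat -> measure_display) (T : forall n : nat, measurableType (d n))
    (Pr : forall n : nat, probability (T n) R)
    (sigma : forall n : nat, 'I_n -> T n -> 'S_n)
    (hp : ranked_rows p)
    (hsigma : forall n : nat, random_environment (Pr n) (@sigma n))
    (hsparse : sparse_rows p) (hnondeg : nondegenerate_rows p)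
    (t : nat -> nat) (ht0 : forall n : nat, (0 < t n)%N)
    (ht : (fun n : nat => (t n)%:R : R^o)
            \is 'Theta_\oo(fun n : nat => ln n%:R : R^o))
    (eps : R) (heps : 0 < eps) :
  uniformly_unlikely Pr sigma p (t := t) (fun n P x =>
    weight P x \notin
      `[expR (- ((1 + eps) * entropy (p n) * (t n)%:R)),
        expR (- ((1 - eps) * entropy (p n) * (t n)%:R))]).
Proof.
move=> del del0.
have p_ge0 n i j : 0 <= p n i j by have [_ p0 _] := hp n i; exact: p0.
have p_sum1 n i : \sum_j p n i j = 1 by have [] := hp n i.
under eq_fun => n do rewrite event_probability ?ltW //.
apply: cvg_EFin; first by near=> n.
apply/cvgr0Pnorm_le => th th0.
have [[c1 c2] /= /andP[c1_gt0 c2_gt0] t_bounds] := asboolP _ ht.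
have [_ /eqoP max_log2_o] := hsparse.
(* The constants are chosen in order of dependence: [e0] for cycle weights and entropy, [K] for the
   number of turns, [a] for the dispersion time, [q], [e2] and [e] for the moment bound, [c] for the
   exponent of [lam], [v] for the second moment, and [A] for the size of [n]. *)
have eta0 : 0 < Num.min 2^-1 (th / 16) by rewrite lt_min invr_gt0 divr_gt0 //= ltr0n.
have [e0 [e00 e0_le frac_e0]] := frac_above_small hnondeg eta0.
have [K Kdel] : exists K, (1 - e0) ^+ K <= del / 8.
  by apply: small_power; rewrite ?divr_gt0 //; apply/andP; split; lra.
pose a := Num.min 1 (eps / 2) * c1 / K.+2%:R.
have a0 : 0 < a by rewrite divr_gt0 // mulr_gt0 // lt_min ltr01 divr_gt0.
have aK : K.+2%:R * a = Num.min 1 (eps / 2) * c1 by rewrite mulrC divfK.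
pose q := expR (- (6 / a)).
have q0 : 0 < q by exact: expR_gt0.
have [e2 [e20 e2_le frac_e2]] := frac_above_small hnondeg (divr_gt0 q0 (ltr0n R 3)).
have [e e2q] : exists e, (1 - e2) ^+ e <= q / 3.
  by apply: small_power; rewrite ?divr_gt0 //; apply/andP; split; lra.
pose c := Num.min 8^-1 (Num.min (e.+1%:R)^-1 (eps * e0 * c1 / 16)).
have c0 : 0 < c by rewrite !lt_min ?invr_gt0 ?ltr0n ?divr_gt0 ?mulr_gt0.
have c8 : 8 * c <= 1.
  by rewrite -ler_pdivlMl // mulr1 ge_min lexx.
have ce : c * e%:R <= 1.
  apply: (@le_trans _ _ (c * e.+1%:R));
    first by rewrite ler_wpM2l ?(ltW c0) // ler_nat.
  by rewrite -ler_pdivlMr // mul1r !ge_min lexx orbT.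
have c_eps : c <= eps * e0 * c1 / 16 by rewrite !ge_min lexx !orbT.
(* [v1] controls small steps, [v2] the Chebyshev bound. *)
pose v1 := del / 8 * c ^+ 2.
pose v2 := del / 4 * expR (- 3) / 2 * (eps * e0 * c1 / 8) ^+ 2.
pose v := Num.min v1 v2 / c2.
have v10 : 0 < v1 by rewrite mulr_gt0 ?divr_gt0 ?exprn_gt0.
have v20 : 0 < v2 by rewrite !mulr_gt0 ?invr_gt0 ?expR_gt0 ?exprn_gt0 ?mulr_gt0
  ?invr_gt0.
have v0 : 0 < v by rewrite divr_gt0 // lt_min v10.
have c2v : c2 * v = Num.min v1 v2 by rewrite mulrC divfK // gt_eqF.
pose D := 4 * c2 + 1.
have D1 : 1 <= D by rewrite lerDr mulr_ge0 // ltW.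
have D0 : 0 < D by apply: lt_le_trans D1.
(* A pair of numbers stands for the requirement that the first is at most [A] times the second; the
   sum of all ratios meets every one. *)
pose bounds : seq (R * R) := [:: (2 * D ^+ 2, 1); (3 * D, q); (48 * D ^+ 2, del);
  (8 * D ^+ 2, del * expR (- 3)); (128 * D ^+ 4, del * th); (16 * D ^+ 5, th);
  (16, th); (128 * expR (12 / a), del * th)].
pose A := \sum_(b <- bounds) b.1 / b.2.
have bounds_gt0 b : b \in bounds -> 0 < b.1 /\ 0 < b.2.
  rewrite !inE; do ?case/orP; move=> /eqP -> /=; split;
  by rewrite ?mulr_gt0 ?exprn_gt0 ?expR_gt0 ?ltr0n ?ltr01.
have A_ge b : b \in bounds -> b.1 <= A * b.2.
  move=> bb; have [_ b2] := bounds_gt0 b bb; rewrite -ler_pdivrMr //.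
  apply: (@ler_sum_mem _ _ bounds (fun b => b.1 / b.2)) => // b' /bounds_gt0[b'1 b'2].
  by rewrite divr_ge0 // ltW.
near=> n.
have x1 : 1 <= ln n%:R :> R by near: n; exact: ln_infty.
have ax : 2 <= a * ln n%:R.
  by rewrite mulrC -ler_pdivrMr //; near: n; exact: ln_infty.
have x0 : 0 <= ln n%:R :> R by apply: le_trans x1.
have [t_ge t_le] : c1 * ln n%:R <= (t n)%:R /\ (t n)%:R <= c2 * ln n%:R.
  have : c1 * `|ln n%:R : R^o| <= `|(t n)%:R : R^o| /\ `|(t n)%:R : R^o| <=
    c2 * `|ln n%:R : R^o|.
    by near: n.
  by rewrite !ger0_norm.
have V_le : max_log2 (p n) <= v * ln n%:R.
  have : `|max_log2 (p n) : R^o| <= v * `|ln n%:R : R^o| by near: n;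
    exact: max_log2_o.
  by rewrite !ger0_norm // max_log2_ge0.
have AX : A * (1 + ln n%:R) ^+ 7 <= expR (c * ln n%:R) by near: n; exact: expR_poly.
have frac0 : frac_above (p n) (1 - e0) <= Num.min 2^-1 (th / 16) by near: n.
have frac2 : frac_above (p n) (1 - e2) <= q / 3 by near: n.
move: frac0; rewrite le_min => /andP[frac_half frac_th].
rewrite /= ger0_norm; last by rewrite divr_ge0 // sumr_ge0.
apply: (@atypical_fraction R n (p n) (t n) (p_ge0 n)
  (p_sum1 n) eps del th c1 c2 e0 e2 a c v D A K e) => //.
- by rewrite aK mulrC ler_wpM2l ?(ltW c1_gt0) // ge_min lexx orbT.
- by rewrite aK ler_piMl ?(ltW c1_gt0) // ge_min lexx.
- by apply: le_trans e2_le _; rewrite invf_le1 ?ler1n.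
- by rewrite c2v ge_min lexx.
- by rewrite c2v ge_min lexx orbT.
- by rewrite -[leRHS]mulr1; apply: (A_ge (2 * D ^+ 2, 1)); rewrite !inE eqxx.
- by apply: (A_ge (3 * D, q)); rewrite !inE eqxx ?orbT.
- by apply: (A_ge (48 * D ^+ 2, del)); rewrite !inE eqxx ?orbT.
- by apply: (A_ge (8 * D ^+ 2, del * expR (- 3))); rewrite !inE eqxx ?orbT.
- by apply: (A_ge (128 * D ^+ 4, del * th)); rewrite !inE eqxx ?orbT.
- by apply: (A_ge (16 * D ^+ 5, th)); rewrite !inE eqxx ?orbT.
- by apply: (A_ge (16, th)); rewrite !inE eqxx ?orbT.
- by apply: (A_ge (128 * expR (12 / a), del * th)); rewrite !inE eqxx ?orbT.
Unshelve. all: by end_near. Qed.
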